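(* For every integer $n\geq 3$, $$\operatorname{spex}_{\kappa}(n,K_3;2)=\begin{cases}0,&n=3,\\ 1,&n=4,\\ 2,&n=5,\\ \rho(B_{n,2}),&n\geq 6.\end{cases}$$ For $n=3$ the unique extremal graph is the empty (edgeless) graph. For $n=4$ the extremal graphs are $K_2\cup 2K_1$ and $2K_2$. For $n=5$ the unique extremal graph is $C_5$, and for every $n\geq 6$ the unique extremal graph is $B_{n,2}$ (all up to isomorphism). Consequently, $n_0(2)=6$.
   Context: All graphs are finite, simple and undirected. $\rho(G)$ denotes the largest eigenvalue of the adjacency matrix of $G$, and $\overline{G}$ is the complement of $G$. The vertex-connectivity $\kappa(H)$ is the minimum number of vertices whose deletion disconnects $H$ or leaves a single vertex; in particular $\kappa(K_n)=n-1$. Define $$\operatorname{spex}_{\kappa}(n,K_3;k):=\max\{\rho(G): |V(G)|=n,\ G\text{ is triangle-free},\ \kappa(\overline{G})\geq k\};$$ an extremal graph is a graph in this family attaining the maximum. For $n\geq 2k$, $B_{n,k}$ is the graph obtained from the complete bipartite graph $K_{\lceil n/2\rceil,\lfloor n/2\rfloor}$ by deleting the edges of a matching of size $k$ (up to isomorphism, independent of the matching chosen). When it exists, $n_0(k)$ denotes the least integer $N$ such that $B_{n,k}$ is the unique (up to isomorphism) extremal graph for $\operatorname{spex}_{\kappa}(n,K_3;k)$ for every $n\geq N$. $K_2\cup 2K_1$ is the disjoint union of an edge and two isolated vertices, $2K_2$ is the disjoint union of two edges, and $C_5$ is the cycle on five vertices. *)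

(* Defs.v *)
From HB Require Import structures.
From mathcomp Require Import all_boot all_order all_algebra.
From mathcomp Require Import classical_sets reals.

Set Implicit Arguments.
Unset Strict Implicit.
Unset Printing Implicit Defensive.

Import Order.TTheory GRing.Theory Num.Theory.

Record sgraph (T : finType) := SGraph {
  adj :> rel T;
  adj_sym : symmetric adj;
  adj_irr : irreflexive adj
}.

Definition graph (n : nat) := sgraph 'I_n.

Section Graphs.
Variables T U : finType.

Definition simple_rel (r : rel T) : rel T :=
  fun x y => (x != y) && (r x y || r y x).

Lemma simple_rel_sym (r : rel T) : symmetric (simple_rel r).
Proof. by move=> x y; rewrite /simple_rel eq_sym orbC. Qed.

Lemma simple_rel_irr (r : rel T) : irreflexive (simple_rel r).
Proof. by move=> x; rewrite /simple_rel eqxx. Qed.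

Definition graph_of (r : rel T) : sgraph T :=
  SGraph (simple_rel_sym r) (simple_rel_irr r).

Definition complement (G : sgraph T) : sgraph T :=
  graph_of (fun x y => ~~ G x y).

Definition giso (G : sgraph T) (H : sgraph U) : Prop :=
  exists2 f : T -> U, bijective f & forall x y, H (f x) (f y) = G x y.

Definition gunion_rel (G : sgraph T) (H : sgraph U) : rel (T + U) :=
  fun u v => match u, v with
             | inl x, inl y => G x y
             | inr x, inr y => H x y
             | _, _ => false
             end.

Definition triangle_free (G : sgraph T) : Prop :=
  forall x y z, ~~ [&& G x y, G y z & G x z].

Definition deleted_rel (H : sgraph T) (S : {set T}) : rel T :=
  fun x y => [&& x \notin S, y \notin S & H x y].

(* If S = [set: T] then H - S has no vertices and does not count as
   disconnected. *)
Definition disconnects (H : sgraph T) (S : {set T}) : bool :=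
  [exists x, exists y,
    [&& x \notin S, y \notin S & ~~ connect (deleted_rel H S) x y]].

(* The default value #|T| of the minimum is never attained when T is nonempty:
   the complement of a single vertex is always admissible. *)
Definition kappa (H : sgraph T) : nat :=
  \big[minn/#|T|]_(S : {set T} | disconnects H S || (#|~: S| == 1)) #|S|.

End Graphs.

Definition gunion (T U : finType) (G : sgraph T) (H : sgraph U) :
    sgraph (T + U)%type :=
  graph_of (gunion_rel G H).

Definition edgeless (n : nat) : graph n := graph_of (fun _ _ => false).

Definition complete (n : nat) : graph n := graph_of (fun _ _ => true).

Definition cycle_graph (n : nat) : graph n :=
  graph_of (fun i j : 'I_n => j == i.+1 %% n :> nat).

(* The parts are {0, ..., h - 1} and {h, ..., n - 1} with h = uphalf n, the
   ceiling of n / 2, and the deleted matching is {i, h + i} for i < k. It has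
   exactly k edges when 2 * k <= n. *)
Definition B (n k : nat) : graph n :=
  graph_of (fun i j : 'I_n =>
    (i < uphalf n <= j) && ~~ ((i < k) && (j == uphalf n + i :> nat))).

Local Open Scope ring_scope.
Local Open Scope classical_set_scope.

Section Spectral.
Variable R : realType.

Definition adjmx (n : nat) (G : graph n) : 'M[R]_n :=
  \matrix_(i, j) (G i j)%:R.

(* For n > 0 the set of eigenvalues is finite and, the matrix being symmetric,
   nonempty, so that its supremum is the largest eigenvalue. *)
Definition rho (n : nat) (G : graph n) : R :=
  sup [set a : R | eigenvalue (adjmx G) a].

Definition spex_family (n k : nat) : set (graph n) :=
  [set G | triangle_free G /\ (k <= kappa (complement G))%N].
Arguments spex_family : clear implicits.

(* There are finitely many graphs on 'I_n, so that the supremum is a maximum as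
   soon as the family is nonempty. *)
Definition spex_kappa (n k : nat) : R :=
  sup [set rho G | G in spex_family n k].

Definition extremal (n k : nat) (G : graph n) : Prop :=
  spex_family n k G /\ forall H : graph n, spex_family n k H -> rho H <= rho G.

Definition unique_extremal (n k : nat) (X : graph n) : Prop :=
  forall G : graph n, extremal k G <-> giso G X.

Definition eventually_B (k N : nat) : Prop :=
  forall n : nat, (N <= n)%N -> (2 * k <= n)%N /\ unique_extremal k (B n k).

Definition is_n0 (k N : nat) : Prop :=
  eventually_B k N /\ forall M : nat, eventually_B k M -> (N <= M)%N.

End Spectral.

(* Main.v *)
Require Import Defs.
From HB Require Import structures.
From mathcomp Require Import all_boot all_order all_algebra.
From mathcomp Require Import boolp classical_sets reals.
From mathcomp Require Import fintype finset zify lra.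

(* A symmetric nonnegative matrix [A] with [A z <= c z] for some positive [z]
   has all its eigenvalues at most [c], and Perron-Frobenius makes this strict
   for a proper subgraph of a connected graph with [A z = c z].

   Let [n >= 6]. If, for every vertex [v], some edge [xy] avoids the
   neighbourhood of [v], then every neighbour of [v] misses the other neighbours
   of [v] and one of [x], [y], so that at most [d (n - 1 - d)] walks of length 2
   start at a vertex of degree [d], and the square of every eigenvalue is at
   most the integer part of [(n - 1)^2 / 4]. This is below [rho (B n 2) ^ 2]
   unless [n] is 6 or 7, where the graphs reaching the bound are blow-ups of the
   5-cycle, for which an explicit [z] does better. Otherwise the graph is
   bipartite, between the neighbourhood [X] of some [v] and its complement, and
   2-connectedness of the complement graph yields two disjoint non-edges across.
   The complete bipartite graph with parts of sizes [a], [b] minus two disjoint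
   edges has for squared spectral radius the larger root of [l ^ 2 - (a b - 3) l
   + (a - 2) (b - 2)], which is largest for balanced parts.

   For [n <= 5] the degrees are at most [n - 3]. *)

Set Implicit Arguments.
Unset Strict Implicit.
Unset Printing Implicit Defensive.

Import Order.TTheory GRing.Theory Num.Theory.

Local Open Scope ring_scope.

(** * Eigenvalue bounds from positive weights *)

Section WeightedSums.
Variables (R : realType) (T : finType) (G : sgraph T).
Implicit Types x y z : T -> R.

Definition nbsum (H : rel T) z u := \sum_(w | H u w) z w.

Definition eigenfun (t : R) x :=
  (exists u, x u != 0) /\ forall u, nbsum G x u = t * x u.

Lemma nbsum_adjoint (H : sgraph T) y z :
  \sum_u z u * nbsum H y u = \sum_u y u * nbsum H z u.
Proof.
rewrite /nbsum; under eq_bigr do rewrite mulr_sumr.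
rewrite (exchange_big_dep xpredT) //=; apply: eq_bigr => w _.
rewrite mulr_sumr; apply: eq_big => [u|u _]; first by rewrite adj_sym.
by rewrite mulrC.
Qed.

Lemma nbsum_subrel (e e' : rel T) z u :
  (forall w, 0 <= z w) -> (forall w, e u w -> e' u w) ->
  nbsum e z u <= nbsum e' z u.
Proof.
move=> z_ge0 see'; rewrite /nbsum [leLHS]big_mkcond [leRHS]big_mkcond.
apply: ler_sum => w _; case: ifP => [/see'->//|_].
by case: ifP.
Qed.

Lemma nbsum_norm t x u :
  eigenfun t x -> `|t| * `|x u| <= nbsum G (fun w => `|x w|) u.
Proof. by case=> _ xE; rewrite -normrM -xE; apply: ler_norm_sum. Qed.

Lemma weighted_norm_gt0 t x z :
  (forall u, 0 < z u) -> eigenfun t x -> 0 < \sum_u `|x u| * z u.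
Proof.
move=> z_gt0 [[u xu] _]; rewrite (bigD1 u) //= ltr_wpDr //.
  by apply: sumr_ge0 => w _; rewrite mulr_ge0 // ltW.
by rewrite mulr_gt0 ?normr_gt0.
Qed.

(** Pair [|x|] with [z]: the triangle inequality gives [|t| |x| <= nbsum G |x|] pointwise, and
    symmetry of [G] moves the neighbour sum onto [z], where [c] bounds it. *)
Lemma eigen_le t x z c :
    (forall u, 0 < z u) -> (forall u, nbsum G z u <= c * z u) ->
  eigenfun t x -> `|t| <= c.
Proof.
move=> z_gt0 zc ex; have S_gt0 := weighted_norm_gt0 z_gt0 ex.
rewrite -(ler_pM2r S_gt0).
apply: (@le_trans _ _ (\sum_u z u * nbsum G (fun w => `|x w|) u)).
  rewrite mulr_sumr; apply: ler_sum => u _.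
  by rewrite mulrA [leRHS]mulrC ler_wpM2r ?nbsum_norm // ltW.
rewrite nbsum_adjoint mulr_sumr; apply: ler_sum => u _.
by rewrite mulrCA ler_wpM2l.
Qed.

(** The same pairing is done twice, first against [z] and then against [nbsum G z]. The latter is
    only known to be nonnegative, which is all that [le1] asks. *)
Lemma eigen_sqr_le t x z c :
    (forall u, 0 < z u) -> (forall u, nbsum G (nbsum G z) u <= c * z u) ->
  eigenfun t x -> t ^+ 2 <= c.
Proof.
move=> z_gt0 zc ex; have S_gt0 := weighted_norm_gt0 z_gt0 ex.
rewrite -(ler_pM2r S_gt0) -real_normK ?num_real // expr2.
have nz_ge0 u : 0 <= nbsum G z u by apply: sumr_ge0 => w _; rewrite ltW.
have le1 y : (forall u, 0 <= y u) ->
    `|t| * \sum_u `|x u| * y u <= \sum_u `|x u| * nbsum G y u.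
  move=> y_ge0; rewrite -nbsum_adjoint mulr_sumr; apply: ler_sum => u _.
  by rewrite mulrA [leRHS]mulrC ler_wpM2r ?nbsum_norm.
rewrite -mulrA; apply: (@le_trans _ _ (`|t| * \sum_u `|x u| * nbsum G z u)).
  by rewrite ler_wpM2l // le1 // => u; rewrite ltW.
apply: le_trans (le1 _ nz_ge0) _; rewrite mulr_sumr.
by apply: ler_sum => u _; rewrite mulrCA ler_wpM2l.
Qed.

(* Perron-Frobenius: pairing with the positive eigenfunction [z] of [H] forces
   [|x|] to be an eigenfunction of both graphs, hence positive. *)
Lemma subgraph_same_eigenvalue (H : sgraph T) t x z :
    (forall u w, G u w -> H u w) -> (forall u w, connect H u w) ->
    (forall u, 0 < z u) -> (forall u, nbsum H z u = t * z u) ->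
  eigenfun t x -> forall u w, G u w = H u w.
Proof.
move=> sGH connH z_gt0 zE ex.
pose y u := `|x u|; have y_ge0 u : 0 <= y u by apply: normr_ge0.
have GH_le u : nbsum G y u <= nbsum H y u.
  by apply: nbsum_subrel => // w; apply: sGH.
have ty_le u : t * y u <= nbsum G y u.
  apply: le_trans (nbsum_norm u ex); rewrite ler_wpM2r ?ler_norm //.
have adjH : \sum_u z u * (nbsum H y u - t * y u) = 0.
  under eq_bigr do rewrite mulrBr; rewrite sumrB.
  rewrite nbsum_adjoint.
  by rewrite -sumrB big1 // => u _; rewrite zE; lra.
have HE u : nbsum H y u = t * y u.
  have /eqP := adjH; rewrite psumr_eq0 => [/allP/(_ u)|w _]; last first.
    by rewrite mulr_ge0 ?subr_ge0 ?(le_trans (ty_le w)) // ltW.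
  rewrite mem_index_enum => /(_ isT).
  by rewrite mulf_eq0 gt_eqF ?z_gt0 //= subr_eq0 => /eqP.
have GE u : nbsum G y u = nbsum H y u.
  by apply/eqP; rewrite eq_le GH_le HE ty_le.
(* A zero of [y] has neighbour sum zero, so zeros spread along the edges of [H]; by connectedness
   one zero would make [x] vanish. *)
have y0_closed u w : H u w -> y u = 0 -> y w = 0.
  move=> Huw yu0; have /eqP := HE u; rewrite yu0 mulr0 psumr_eq0 //.
  by move=> /allP/(_ w); rewrite mem_index_enum Huw => /(_ isT)/eqP.
have y_gt0 u : 0 < y u.
  rewrite lt_neqAle y_ge0 andbT eq_sym; apply/eqP => yu0.
  case: (ex) => -[v xv] _; have : y v == 0.
    have /connectP[p Hp ->] := connH u v.
    elim: p u yu0 Hp => [|w p IH] u yu0 /=; first by rewrite yu0.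
    by case/andP=> /y0_closed/(_ yu0)/IH; apply.
  by rewrite normr_eq0 (negPf xv).
move=> u w; apply/idP/idP => [|Huw]; first exact: sGH.
(* All values of [y] are positive, so an edge of [H] absent from [G] would separate the two
   neighbour sums at [u]. *)
apply/negPn/negP => nGuw; have /eqP := GE u.
rewrite /nbsum [X in _ == X](bigID (G u)) /=.
have -> : \sum_(i | H u i && G u i) y i = \sum_(i | G u i) y i.
  by apply: eq_bigl => v; case Guv: (G u v); rewrite ?andbF // sGH.
rewrite -[X in X == _]addr0 (inj_eq (addrI _)) eq_sym psumr_eq0 // => /allP/(_ w).
by rewrite mem_index_enum Huw nGuw gt_eqF ?y_gt0 // => /(_ isT).
Qed.
End WeightedSums.

(** * The spectral radius as a supremum of eigenvalues *)

Section SpectralRadius.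
Variables (R : realType) (n : nat).
Implicit Types G H : graph n.

Lemma eigenvalue_eigenfun G (t : R) :
  eigenvalue (adjmx R G) t <-> exists x, eigenfun G t x.
Proof.
have mulE (v : 'rV[R]_n) u :
    (v *m adjmx R G) 0 u = nbsum G (fun w => v 0 w) u.
  rewrite mxE /nbsum [RHS]big_mkcond /=; apply: eq_bigr => w _.
  by rewrite mxE adj_sym; case: (G u w); rewrite ?mulr1 ?mulr0.
split=> [/eigenvalueP[v vE v0]|[x [[u xu] xE]]].
  exists (fun w => v 0 w); split=> [|u]; last by rewrite -mulE vE mxE.
  by have /rV0Pn[w vw] := v0; exists w.
apply/eigenvalueP; exists (\row_w x w).
  apply/rowP => w; rewrite mulE !mxE -xE /nbsum.
  by apply: eq_bigr => v _; rewrite mxE.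
by apply/rV0Pn; exists u; rewrite mxE.
Qed.

Lemma roots_seq (p : {poly R}) :
  p != 0 -> exists s : seq R, forall a, root p a -> a \in s.
Proof.
have [m] := ubnP (size p); elim: m p => // m IH p size_p p0.
have [[a pa]|noroot] := pselect (exists a, root p a); last first.
  by exists [::] => a pa; case: noroot; exists a.
have /factor_theorem[q pE] := pa.
have q0 : q != 0 by apply: contra_neq p0 => q0; rewrite pE q0 mul0r.
have [|s sP] := IH q _ q0.
  by move: size_p; rewrite pE size_Mmonic ?monicXsubC // size_XsubC addn2.
exists (a :: s) => b; rewrite pE rootM root_XsubC inE => /orP[/sP ->|->] //.
by rewrite orbT.
Qed.

Lemma eigenfun_seq G :
  exists s : seq R, forall t x, eigenfun G t x -> t \in s.
Proof.
have [s sP] := roots_seq (monic_neq0 (char_poly_monic (adjmx R G))).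
exists s => t x ex; apply: sP; rewrite -eigenvalue_root_char.
by apply/eigenvalue_eigenfun; exists x.
Qed.

(** The supremum of an empty set is 0 by convention, whence the assumption that [c] is
    nonnegative. *)
Lemma rho_le G c :
  0 <= c -> (forall t x, eigenfun G t x -> t <= c) -> rho R G <= c.
Proof.
move=> c_ge0 tc; rewrite /rho; set E := (X in sup X).
have [->|/set0P[t0 Et0]] := eqVneq E classical_sets.set0; first by rewrite sup0.
apply: ge_sup; first by exists t0.
move=> t /= /eigenvalue_eigenfun[x]; exact: tc.
Qed.

(** Strictness passes to the supremum because there are finitely many eigenvalues: [c'] is the
    largest among 0 and the elements of [s] below [c]. *)
Lemma rho_lt G c :
  0 < c -> (forall t x, eigenfun G t x -> t < c) -> rho R G < c.
Proof.
move=> c_gt0 tc; have [s sP] := eigenfun_seq G.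
have [c' [c'_ge0 c'c sc']] : exists c', [/\ 0 <= c', c' < c &
    forall t, t \in s -> t < c -> t <= c'].
  elim: s {sP} => [|a s [c' [c'_ge0 c'c sc']]]; first by exists 0.
  have [ac|ca] := ltP a c.
    exists (Num.max a c'); split; first by rewrite le_max c'_ge0 orbT.
      by rewrite gt_max ac.
    move=> t; rewrite inE le_max => /predU1P[->|/sc' tc' /tc' ->].
      by rewrite lexx.
    by rewrite orbT.
  exists c'; split=> // t; rewrite inE => /predU1P[->|]; last exact: sc'.
  by move/(le_lt_trans ca); rewrite ltxx.
apply: le_lt_trans c'c; apply: rho_le => // t x ex.
by apply: sc'; [exact: sP ex | exact: tc ex].
Qed.

(** A supremum bounds its set only when the set is bounded; the constant weight 1 bounds every
    eigenvalue by [n]. *)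
Lemma eigen_le_rho G t x : eigenfun G t x -> t <= rho R G.
Proof.
move=> ex; apply: ub_le_sup; last first.
  by apply/eigenvalue_eigenfun; exists x.
exists n%:R => {ex}t /= /eigenvalue_eigenfun[{}x ex].
apply: le_trans (ler_norm _) _.
apply: (@eigen_le _ _ G t x (fun=> 1)) => // u.
rewrite /nbsum sumr_const mulr1 ler_nat.
by rewrite -[leqRHS](card_ord n) max_card.
Qed.

Lemma rho_eq G t x :
  0 <= t -> eigenfun G t x ->
  (forall s y, eigenfun G s y -> s <= t) -> rho R G = t.
Proof.
move=> t_ge0 ex tmax; apply/eqP.
by rewrite eq_le rho_le // (eigen_le_rho ex).
Qed.

End SpectralRadius.

(** * Transport along graph isomorphisms *)

Section Isomorphisms.

Lemma giso_refl (T : finType) (G : sgraph T) : giso G G.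
Proof. by exists id => //; exists id. Qed.

Lemma giso_sym (T U : finType) (G : sgraph T) (H : sgraph U) :
  giso G H -> giso H G.
Proof.
case=> f [g fK gK] fE; exists g; first by exists f.
by move=> x y; rewrite -fE !gK.
Qed.

Lemma giso_trans (T U V : finType) (G : sgraph T) (H : sgraph U)
    (K : sgraph V) : giso G H -> giso H K -> giso G K.
Proof.
case=> f fb fE [g gb gE]; exists (g \o f); first exact: bij_comp.
by move=> x y /=; rewrite gE fE.
Qed.

Lemma rho_giso (R : realType) n (G H : graph n) :
  giso G H -> rho R G = rho R H.
Proof.
suff half (G1 H1 : graph n) t : giso G1 H1 ->
    eigenvalue (adjmx R H1) t -> eigenvalue (adjmx R G1) t.
  move=> GH; congr sup; apply/seteqP; split=> t /=; apply: half => //.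
  exact: giso_sym.
case=> f fb fE /eigenvalue_eigenfun[x [[u xu] xE]].
apply/eigenvalue_eigenfun; exists (x \o f); split=> [|w /=].
  by case: (fb) => g _ gK; exists (g u) => /=; rewrite gK.
rewrite -xE /nbsum [RHS](reindex f) /=; last exact: onW_bij.
by apply: eq_bigl => v; rewrite fE.
Qed.

(** Serves to give an isomorphism as a list of all vertices of [G]: position [i] of the list
    corresponds to the vertex [i] of [H]. *)
Lemma giso_of_seq (T : finType) n (G : sgraph T) (H : graph n) (s : seq T) x0 :
    uniq s -> size s = n -> #|T| = n ->
    (forall i j : 'I_n, G (nth x0 s i) (nth x0 s j) = H i j) ->
  giso G H.
Proof.
move=> us sz cT GH; apply: giso_sym.
exists (fun i : 'I_n => nth x0 s i) => //.
apply: inj_card_bij; last by rewrite cT card_ord.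
move=> i j /eqP; rewrite nth_uniq ?sz ?ltn_ord // => /eqP ij.
exact: val_inj.
Qed.

End Isomorphisms.

(** * Connectivity at least two as absence of a cut vertex *)

Section Connectivity.

Lemma exists_notin (T : finType) (s : seq T) :
  (size s < #|T|)%N -> exists x, x \notin s.
Proof.
move=> sT; apply/existsP; rewrite -negb_forall; apply: contraL sT => /forallP sT.
rewrite -leqNgt (leq_trans _ (card_size s)) //.
by apply: subset_leq_card; apply/subsetP => x _; apply: sT.
Qed.

Lemma leq_bigmin (I : finType) (P : pred I) (F : I -> nat) m k :
  (k <= \big[minn/m]_(i | P i) F i)%N =
  (k <= m)%N && [forall i, P i ==> (k <= F i)%N].
Proof.
have -> : [forall i, P i ==> (k <= F i)%N] =
    all (fun i => P i ==> (k <= F i)%N) (index_enum I).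
  by apply/forallP/allP => [h i _|h i]; apply: h; rewrite ?mem_index_enum.
elim: (index_enum I) => [|i r IH]; first by rewrite big_nil andbT.
by rewrite big_cons /=; case: (P i); rewrite ?leq_min IH //= andbCA.
Qed.

Lemma deleted_sym (T : finType) (H : sgraph T) (S : {set T}) :
  symmetric (deleted_rel H S).
Proof. by move=> x y; rewrite /deleted_rel adj_sym andbCA. Qed.

(** A set of at most one vertex that avoids [x] and [y] lies in some [[set v]] with [v] different
    from both, and a path avoiding [v] survives the smaller deletion. A set whose deletion leaves
    one vertex has at least two elements. *)
Lemma kappa_ge2P (T : finType) (H : sgraph T) : (2 < #|T|)%N ->
  reflect (forall v x y, x != v -> y != v ->
             connect (deleted_rel H [set v]) x y)
          (2 <= kappa H)%N.
Proof.
move=> T_gt2; rewrite /kappa leq_bigmin ltnW //=.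
apply: (iffP forallP) => [h v x y xv yv|h S].
  apply/negPn/negP => nc; have /implyP := h [set v].
  suff -> : disconnects H [set v] by rewrite cards1 => /(_ isT).
  apply/existsP; exists x.
  by apply/existsP; exists y; rewrite !inE xv yv.
apply/implyP => /orP[|/eqP cS]; last by have := cardsC S; lia.
case/existsP=> x /existsP[y /and3P[xS yS nc]].
rewrite ltnNge; apply: contra nc => S1.
have [v [vx vy Sv]] : exists v, [/\ v != x, v != y & S \subset [set v]].
  (* For empty [S], any third vertex serves as [v]. *)
  have [S0|[v vS]] := set_0Vmem S.
    have [v] := exists_notin (T_gt2 : (size [:: x; y] < _)%N).
    rewrite !inE negb_or => /andP[vx vy].
    by exists v; split=> //; rewrite S0 sub0set.
  exists v; split; [by apply: contraNneq xS => <- | by apply: contraNneq yS => <- |].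
  apply/subsetP => w wS; rewrite inE; apply/eqP.
  exact: (card_le1_eqP S1).
have := h v x y; rewrite 2![_ == v]eq_sym => /(_ vx vy).
apply: connect_sub => a b /and3P[av bv Hab]; apply: connect1.
have nS := contra (subsetP Sv _).
by rewrite /deleted_rel Hab !nS.
Qed.

Lemma kappa_ge2_giso (T U : finType) (G : sgraph T) (H : sgraph U) :
  (2 < #|T|)%N -> giso G H ->
  (2 <= kappa (complement G))%N -> (2 <= kappa (complement H))%N.
Proof.
move=> T_gt2 GH; have [f fb fE] := GH; have [g fK gK] := fb.
have U_gt2 : (2 < #|U|)%N by rewrite -(bij_eq_card fb).
move/(kappa_ge2P _ T_gt2) => h; apply/(kappa_ge2P _ U_gt2) => v x y xv yv.
have := h (g v) (g x) (g y).
rewrite !(can_eq gK) => /(_ xv yv) /connectP[p].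
move=> gp gy; rewrite -[x]gK -[y]gK gy; move: (g x) gp => a {gy xv yv}.
elim: p a => [|b p IH] a //= /andP[ab pb].
apply: connect_trans (IH _ pb); apply: connect1; move: ab.
rewrite /deleted_rel /= /simple_rel !inE.
have fv c : (f c == v) = (c == g v) by rewrite -{1}[v]gK (can_eq fK).
by rewrite !fv (can_eq fK) !fE.
Qed.

End Connectivity.

(** * Complete bipartite graphs minus two disjoint edges *)

Section BipartiteMinusTwoEdges.
Variables (T : finType) (X : {set T}) (x1 x2 y1 y2 : T).

(** The relation goes from [X] to its complement only; [graph_of] makes it symmetric. *)
Definition bip2 : sgraph T := graph_of (fun u w =>
  [&& u \in X, w \notin X, ~~ ((u == x1) && (w == y1))
    & ~~ ((u == x2) && (w == y2))]).

Lemma bip2_l u w : u \in X ->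
  bip2 u w = [&& w \notin X, ~~ ((u == x1) && (w == y1))
                & ~~ ((u == x2) && (w == y2))].
Proof.
move=> uX; rewrite /bip2 /= /simple_rel uX andbF orbF /=.
case: (boolP (w \in X)) => wX /=; first by rewrite andbF.
suff -> : u != w by [].
by apply: contraNneq wX => <-.
Qed.

Lemma bip2_r u w : u \notin X ->
  bip2 u w = [&& w \in X, ~~ ((w == x1) && (u == y1))
                & ~~ ((w == x2) && (u == y2))].
Proof.
move=> uX; rewrite adj_sym; case: (boolP (w \in X)) => wX.
  by rewrite bip2_l // uX.
by rewrite /bip2 /= /simple_rel (negPf uX) (negPf wX) andbF.
Qed.

Hypotheses (x1X : x1 \in X) (x2X : x2 \in X) (y1X : y1 \notin X)
  (y2X : y2 \notin X) (x12 : x1 != x2) (y12 : y1 != y2).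

(** [x0] and [y0] lose no edge: vertices outside [X] are adjacent to [x0], and those of [X] reach it
    through [y0]. *)
Lemma bip2_connect x0 y0 u w :
  x0 \in X -> x0 \notin [set x1; x2] -> y0 \notin X ->
  y0 \notin [set y1; y2] -> connect bip2 u w.
Proof.
move=> x0X x0n y0X y0n; move: x0n y0n; rewrite !inE !negb_or.
move=> /andP[x01 x02] /andP[y01 y02].
have to_x0 v : connect bip2 v x0.
  have [vX|vX] := boolP (v \in X).
    apply: (@connect_trans _ _ y0); apply: connect1.
      by rewrite bip2_l // y0X (negPf y01) (negPf y02) !andbF.
    by rewrite bip2_r // x0X (negPf x01) (negPf x02).
  by apply: connect1; rewrite bip2_r // x0X (negPf x01) (negPf x02).
apply: connect_trans (to_x0 u) _.
by rewrite (sym_connect_sym (adj_sym bip2)).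
Qed.

Variable R : realType.
Implicit Types p q r s l : R.

Definition pairval p q (v1 v2 : T) w := if (w == v1) || (w == v2) then p else q.

Lemma sum_pairval (Y : {set T}) v1 v2 p q :
    v1 \in Y -> v2 \in Y -> v1 != v2 ->
  \sum_(w in Y) pairval p q v1 v2 w = 2 * p + (#|Y|%:R - 2) * q.
Proof.
move=> v1Y v2Y v12; rewrite (bigD1 v1) //= (bigD1 v2) /=; last first.
  by rewrite v2Y eq_sym.
rewrite /pairval !eqxx orbT /=.
rewrite (eq_bigr (fun=> q)) => [|w /andP[/andP[_ w1] w2]]; last first.
  by rewrite (negPf w1) (negPf w2).
rewrite (eq_bigl (mem (Y :\ v1 :\ v2))) => [|w]; last first.
  by rewrite /= !inE andbC [(w \in Y) && _]andbC.
rewrite sumr_const -mulr_natl (cardsD1 v1 Y) (cardsD1 v2 (Y :\ v1)).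
rewrite v1Y !inE v2Y eq_sym v12 /= !natrD; set c := #|_|%:R.
by lra.
Qed.

(** These are the functions constant on the four classes of an equitable partition: [x1] and [x2],
    the rest of [X], [y1] and [y2], the remaining vertices. *)
Definition bipval p q r s u :=
  if u \in X then pairval p q x1 x2 u else pairval r s y1 y2 u.

(** A vertex of [X] sees the whole complement, except that [x1] misses [y1] and [x2] misses [y2],
    each of value [r]. *)
Lemma nbsum_bip2_l p q r s u : u \in X ->
  nbsum bip2 (bipval p q r s) u =
    pairval (r + (#|~: X|%:R - 2) * s) (2 * r + (#|~: X|%:R - 2) * s) x1 x2 u.
Proof.
move=> uX; have y1Y : y1 \in ~: X by rewrite inE.
have y2Y : y2 \in ~: X by rewrite inE.
have tot := sum_pairval r s y1Y y2Y y12.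
have sumE (P : pred T) : (forall w, bip2 u w = (w \in ~: X) && P w) ->
    nbsum bip2 (bipval p q r s) u =
    \sum_(w in ~: X | P w) pairval r s y1 y2 w.
  move=> PE; apply: eq_big => [w|w]; first exact: PE.
  by rewrite PE inE /bipval => /andP[/negPf->].
rewrite /pairval; have [u1|u1] /= := eqVneq u x1.
  rewrite (sumE (fun w => w != y1)) => [|w]; last first.
    by rewrite bip2_l // inE u1 eqxx (negPf x12) /= andbT.
  by move: tot; rewrite (bigD1 y1) //= /pairval eqxx /=; lra.
have [u2|u2] /= := eqVneq u x2.
  rewrite (sumE (fun w => w != y2)) => [|w]; last first.
    by rewrite bip2_l // inE u2 eqxx [x2 == _]eq_sym (negPf x12) /=.
  by move: tot; rewrite (bigD1 y2) //= /pairval eqxx orbT /=; lra.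
rewrite (sumE xpredT) => [|w]; last first.
  by rewrite bip2_l // inE (negPf u1) (negPf u2) /= !andbT.
by rewrite -tot; apply: eq_bigl => w; rewrite andbT.
Qed.

Lemma nbsum_bip2_r p q r s u : u \notin X ->
  nbsum bip2 (bipval p q r s) u =
    pairval (p + (#|X|%:R - 2) * q) (2 * p + (#|X|%:R - 2) * q) y1 y2 u.
Proof.
move=> uX; have tot := sum_pairval p q x1X x2X x12.
have sumE (P : pred T) : (forall w, bip2 u w = (w \in X) && P w) ->
    nbsum bip2 (bipval p q r s) u = \sum_(w in X | P w) pairval p q x1 x2 w.
  move=> PE; apply: eq_big => [w|w]; first exact: PE.
  by rewrite PE /bipval => /andP[->].
rewrite /pairval; have [u1|u1] /= := eqVneq u y1.
  rewrite (sumE (fun w => w != x1)) => [|w]; last first.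
    by rewrite bip2_r // u1 eqxx (negPf y12) /= andbT !andbF andbT.
  by move: tot; rewrite (bigD1 x1) //= /pairval eqxx /=; lra.
have [u2|u2] /= := eqVneq u y2.
  rewrite (sumE (fun w => w != x2)) => [|w]; last first.
    by rewrite bip2_r // u2 eqxx [y2 == _]eq_sym (negPf y12) /= andbT !andbF.
  by move: tot; rewrite (bigD1 x2) //= /pairval eqxx orbT /=; lra.
rewrite (sumE xpredT) => [|w]; last first.
  by rewrite bip2_r // (negPf u1) (negPf u2) /= !andbF !andbT.
by rewrite -tot; apply: eq_bigl => w; rewrite andbT.
Qed.

Let a : R := #|X|%:R.
Let b : R := #|~: X|%:R.

(* The values on [X] solve the eigenvalue equations on [X]; those on the
   complement reduce to [0 <= quad a b l]. *)
Definition bipvec l := bipval ((b - 1) * l) (b * l - b + 2)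
  (Num.sqrt l * (l - b + 2)) (Num.sqrt l * (l + 1)).

(** The characteristic polynomial, in the square [l] of the eigenvalue, of the quotient matrix on
    the four classes, for parts of sizes [c] and [d]. *)
Definition quad (c d l : R) := l ^+ 2 - (c * d - 3) * l + (c - 2) * (d - 2).

Lemma bip2_card_ge2 : 2 <= a /\ 2 <= b.
Proof.
rewrite !ler_nat; split.
  have <- : #|[set x1; x2]| = 2%N by rewrite cards2 x12.
  by apply: subset_leq_card; apply/subsetP => w /set2P[] ->.
have <- : #|[set y1; y2]| = 2%N by rewrite cards2 y12.
by apply: subset_leq_card; apply/subsetP => w /set2P[] ->; rewrite inE.
Qed.

Lemma bipvec_gt0 l u : 1 <= l -> b - 2 < l -> 0 < bipvec l u.
Proof.
have [a2 b2] := bip2_card_ge2 => l1 lb.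
have l0 : 0 < l by lra.
have s0 : 0 < Num.sqrt l by rewrite sqrtr_gt0.
rewrite /bipvec /bipval /pairval; case: ifP => _; case: ifP => _.
- by rewrite mulr_gt0 //; lra.
- by have : 0 <= b * (l - 1) by [rewrite mulr_ge0 //; lra]; lra.
- by rewrite mulr_gt0 //; lra.
- by rewrite mulr_gt0 //; lra.
Qed.

(** Off [X] the defect is [quad a b l]: a root yields an eigenfunction, and a nonnegative value
    yields a weight for [eigen_le]. *)
Lemma nbsum_bipvec l u : 0 <= l ->
  nbsum bip2 (bipvec l) u =
    Num.sqrt l * bipvec l u - (if u \in X then 0 else quad a b l).
Proof.
move=> l0; have s2 c : Num.sqrt l * (Num.sqrt l * c) = l * c.
  by rewrite mulrA -expr2 sqr_sqrtr.
rewrite /bipvec /quad; case: (boolP (u \in X)) => uX.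
  rewrite nbsum_bip2_l // /bipval uX /pairval -/b.
  by case: ifP => _; lra.
rewrite nbsum_bip2_r // /bipval (negPf uX) /pairval -/a.
by case: ifP => _; rewrite s2; lra.
Qed.

(** Serves with two choices of [l]: the larger root of [quad a b], and the simpler [a b - 3] for
    unbalanced parts. *)
Lemma bip2_eigen_le (G : sgraph T) l t x :
    1 <= l -> b - 2 < l -> 0 <= quad a b l ->
    (forall u w, G u w -> bip2 u w) ->
  eigenfun G t x -> `|t| <= Num.sqrt l.
Proof.
move=> l1 lb q0 sG; apply: (@eigen_le _ _ _ _ _ (bipvec l)) => u.
  exact: bipvec_gt0.
apply: le_trans (_ : nbsum bip2 (bipvec l) u <= _).
  by apply: nbsum_subrel => [w|w]; [rewrite ltW ?bipvec_gt0 | exact: sG].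
by rewrite nbsum_bipvec; last lra; rewrite gerBl; case: ifP.
Qed.

End BipartiteMinusTwoEdges.

(** * The larger root of the quotient polynomial *)

Section LargeRoot.
Variable R : realType.
Implicit Types c d l : R.

Definition bigroot c d : R :=
  (c * d - 3 + Num.sqrt ((c * d - 3) ^+ 2 - 4 * ((c - 2) * (d - 2)))) / 2.

Lemma discr_ge0 c d : 3 <= c -> 3 <= d ->
  0 <= (c * d - 3) ^+ 2 - 4 * ((c - 2) * (d - 2)).
Proof.
(* The discriminant equals [(c d - 5)^2 + 8 (c + d) - 32]. *)
by move=> c3 d3; have := sqr_ge0 (c * d - 5); rewrite !expr2; lra.
Qed.

Lemma quad_bigroot c d : 3 <= c -> 3 <= d -> quad c d (bigroot c d) = 0.
Proof.
move=> c3 d3; rewrite /quad /bigroot; have := sqr_sqrtr (discr_ge0 c3 d3).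
by set s := Num.sqrt _; rewrite !expr2 => s2; lra.
Qed.

(** A negative value places [l] between the two roots. Comparisons with the root thus become
    polynomial inequalities. *)
Lemma lt_bigroot c d l : 3 <= c -> 3 <= d -> quad c d l < 0 -> l < bigroot c d.
Proof.
move=> c3 d3; rewrite /quad /bigroot => ql.
have := sqr_sqrtr (discr_ge0 c3 d3); have := sqrtr_ge0 (R := R).
move=> /(_ ((c * d - 3) ^+ 2 - 4 * ((c - 2) * (d - 2)))).
set s := Num.sqrt _ => s_ge0 s2; rewrite ltNge; apply/negP => le_l.
(* This product equals [4 quad c d l]. *)
have : 0 <= (2 * l - (c * d - 3) - s) * (2 * l - (c * d - 3) + s).
  by apply: mulr_ge0; lra.
by move: s2 ql; rewrite !expr2; lra.
Qed.

Lemma bigroot_ge1 c d : 3 <= c -> 3 <= d -> 1 < bigroot c d.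
Proof.
by move=> c3 d3; apply: lt_bigroot => //; rewrite /quad expr1n; nra.
Qed.

(** Supplies the condition [b - 2 < l] for the positivity of [bipvec]. *)
Lemma bigroot_gt c d : 3 <= c -> 3 <= d -> d - 2 < bigroot c d.
Proof.
move=> c3 d3; apply: lt_bigroot => //.
have -> : quad c d (d - 2) = - ((d - 2) * ((c - 1) * (d - 1))).
  by rewrite /quad expr2; lra.
by rewrite oppr_lt0 !mulr_gt0 //; lra.
Qed.

(* Lowering the product of the part sizes by one already lowers the square of
   the spectral radius below [c' * d' - 3]. *)
Lemma unbalanced_lt_bigroot c d c' d' : 3 <= c -> 3 <= d ->
  c' + d' = c + d -> 2 <= c' -> 2 <= d' -> c' * d' + 1 <= c * d ->
  c' * d' - 3 < bigroot c d.
Proof.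
move=> c3 d3 sum c2 d2 lt_cd; apply: lt_bigroot => //.
(* Equal sums give [(c - 2) (d - 2) = (c' - 2) (d' - 2) + c d - c' d']. *)
have -> : quad c d (c' * d' - 3) =
    (c' - 2) * (d' - 2) - (c * d - c' * d') * (c' * d' - 4).
  by rewrite /quad expr2; nra.
have cd4 : 4 <= c' * d' by nra.
have : c' * d' - 4 <= (c * d - c' * d') * (c' * d' - 4).
  by rewrite ler_peMl; lra.
have : (c' - 2) * (d' - 2) = c' * d' - 2 * (c + d) + 4 by lra.
lra.
Qed.

(** Here [k] bounds a number of walks. For [n] equal to 6 and 7 the root is about 5.83 and 8.77,
    below the integer parts 6 and 9 of [(n - 1)^2 / 4]; hence the sharper conditions on [k]
    there. *)
Lemma nat_lt_bigroot n k : (6 <= n)%N -> (4 * k <= n.-1 ^ 2)%N ->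
  (n = 6 -> k <= 5)%N -> (n = 7 -> k <= 8)%N ->
  k%:R < bigroot (uphalf n)%:R (n./2)%:R.
Proof.
move=> n6 kn k6 k7.
have [n8|n7] := leqP 8 n; last first.
  have [nE|nE] : n = 6%N \/ n = 7%N by lia.
    apply: (@le_lt_trans _ _ 5); first by rewrite ler_nat k6.
    rewrite nE; have : 5 < bigroot 3 3 :> R by apply: lt_bigroot;
      rewrite /quad; lra.
    by [].
  apply: (@le_lt_trans _ _ 8); first by rewrite ler_nat k7.
  rewrite nE; have : 8 < bigroot 4 3 :> R by apply: lt_bigroot;
      rewrite /quad; lra.
  by [].
rewrite uphalf_half; set h := n./2; have nE := odd_double_half n.
have h4 : (4 <= h)%N by rewrite /h; lia.
have h4R : 4 <= h%:R :> R by rewrite ler_nat.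
(* The integer part of [(n - 1)^2 / 4] is [h^2] for [n = 2h + 1] and [h (h - 1)] for [n = 2h];
   [quad] is negative there since [h >= 4]. *)
case: (odd n) nE; rewrite -/h ?add0n ?add1n => nE.
  apply: (@le_lt_trans _ _ (h * h)%:R); first by rewrite ler_nat; nia.
  rewrite natrM -natr1; set x : R := h%:R in h4R *.
  apply: lt_bigroot; [lra | lra |].
  have -> : quad (x + 1) x (x * x) = (3 - x) * x ^+ 2 + (x - 1) * (x - 2).
    by rewrite /quad !expr2; nra.
  by nra.
apply: (@le_lt_trans _ _ (h * h.-1)%:R); first by rewrite ler_nat; nia.
have -> : (h * h.-1)%:R = h%:R * (h%:R - 1) :> R.
  rewrite natrM; congr (_ * _); have -> : h = h.-1.+1 by rewrite prednK //; lia.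
  by rewrite -natr1 addrK.
set x : R := h%:R in h4R *; apply: lt_bigroot; [lra | lra |].
have -> : quad x x (x * (x - 1)) = (3 - x) * (x * (x - 1)) + (x - 2) ^+ 2.
  by rewrite /quad !expr2; nra.
have : 0 <= (x - 4) * (x * (x - 1)) by rewrite !mulr_ge0 //; lra.
by rewrite expr2; lra.
Qed.

End LargeRoot.

(** * Spectral radius of [bip2] and its subgraphs *)

Section BipartiteSpectrum.
Variables (R : realType) (T : finType) (X : {set T}) (x1 x2 y1 y2 : T).
Hypotheses (x1X : x1 \in X) (x2X : x2 \in X) (y1X : y1 \notin X)
  (y2X : y2 \notin X) (x12 : x1 != x2) (y12 : y1 != y2).
Hypotheses (a3 : (3 <= #|X|)%N) (b3 : (3 <= #|~: X|)%N).

Let a : R := #|X|%:R.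
Let b : R := #|~: X|%:R.
Let H := bip2 X x1 x2 y1 y2.
Let r := Num.sqrt (bigroot a b).

Let a3R : 3 <= a. Proof. by rewrite ler_nat. Qed.
Let b3R : 3 <= b. Proof. by rewrite ler_nat. Qed.

Lemma bip2_nbsum u : nbsum H (bipvec X x1 x2 y1 y2 (bigroot a b)) u =
  r * bipvec X x1 x2 y1 y2 (bigroot a b) u.
Proof.
rewrite nbsum_bipvec //; last by have := bigroot_ge1 a3R b3R; lra.
by rewrite quad_bigroot //; case: ifP; rewrite subr0.
Qed.

Lemma bip2_vec_gt0 u : 0 < bipvec X x1 x2 y1 y2 (bigroot a b) u.
Proof.
apply: bipvec_gt0 => //; last exact: bigroot_gt.
by rewrite ltW // bigroot_ge1.
Qed.

Lemma bip2_eigenfun : eigenfun H r (bipvec X x1 x2 y1 y2 (bigroot a b)).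
Proof.
by split; [exists x1; rewrite gt_eqF ?bip2_vec_gt0 | exact: bip2_nbsum].
Qed.

Lemma bip2_sub_eigen_le (G : sgraph T) t x :
  (forall u w, G u w -> H u w) -> eigenfun G t x -> t <= r.
Proof.
move=> sG ex; apply: le_trans (ler_norm _) _.
apply: (bip2_eigen_le x1X x2X y1X y2X x12 y12 _ _ _ sG ex).
- by rewrite ltW // bigroot_ge1.
- exact: bigroot_gt.
- by rewrite quad_bigroot.
Qed.

Lemma extra_elt (Y : {set T}) v1 v2 :
  (3 <= #|Y|)%N -> exists2 w, w \in Y & w \notin [set v1; v2].
Proof.
move=> Y3; suff /set0Pn[w /setDP[wY wn]] : Y :\: [set v1; v2] != set0.
  by exists w.
rewrite -card_gt0; have := cardsID [set v1; v2] Y.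
have : (#|Y :&: [set v1; v2]| <= 2)%N.
  apply: leq_trans (subset_leq_card (subsetIr _ _)) _.
  by rewrite cards2; case: (_ == _).
by lia.
Qed.

(** An eigenvalue of [G] reaching [r] equals [r], and Perron-Frobenius then forces [G = H]. Parts of
    size at least three supply the vertices that make [H] connected. *)
Lemma bip2_sub_eigen_lt (G : sgraph T) :
    (forall u w, G u w -> H u w) ->
  (forall u w, G u w = H u w) \/ forall t x, eigenfun G t x -> t < r.
Proof.
move=> sG; have [[t [x [ex rt]]]|nrt] :=
  pselect (exists t, exists x, eigenfun G t x /\ r <= t); last first.
  right=> t x ex; rewrite ltNge; apply/negP => rt.
  by apply: nrt; exists t, x.
left; have tr : t = r by apply/eqP; rewrite eq_le rt (bip2_sub_eigen_le sG ex).
have [x0 x0X x0n] := extra_elt x1 x2 a3.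
have [y0 y0X y0n] := extra_elt y1 y2 b3.
rewrite inE in y0X.
apply: (subgraph_same_eigenvalue sG _ bip2_vec_gt0 _ ex) => u => [w|].
  exact: bip2_connect x0X x0n y0X y0n.
by rewrite tr bip2_nbsum.
Qed.

End BipartiteSpectrum.

(** * Identification with [B n 2] *)

Section BipartiteIsomorphism.

Lemma bip2C (T : finType) (X : {set T}) x1 x2 y1 y2 u w :
  bip2 (~: X) y1 y2 x1 x2 u w = bip2 X x1 x2 y1 y2 u w.
Proof.
rewrite /bip2 /= /simple_rel !inE !negbK.
rewrite orbC; congr (_ && (_ || _)); rewrite andbCA;
  by congr [&& _, _, ~~ _ & ~~ _]; rewrite andbC.
Qed.

Lemma seq_of_set2 (T : finType) (Y : {set T}) v1 v2 x0 :
    v1 \in Y -> v2 \in Y -> v1 != v2 ->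
  exists s : seq T, [/\ uniq s, size s = #|Y|, s =i Y,
                        nth x0 s 0 = v1 & nth x0 s 1 = v2].
Proof.
move=> v1Y v2Y v12; exists [:: v1, v2 & enum (Y :\ v1 :\ v2)].
have sY : [:: v1, v2 & enum (Y :\ v1 :\ v2)] =i Y.
  move=> w; rewrite !inE mem_enum !inE.
  by case: eqVneq => [->|_] //=; case: eqVneq => [->|].
have us : uniq [:: v1, v2 & enum (Y :\ v1 :\ v2)].
  by rewrite /= !inE !mem_enum !inE !eqxx !andbF (negPf v12) enum_uniq.
by split=> //; rewrite -(card_uniqP us); apply: eq_card.
Qed.

(** List [X] starting with [x1], [x2], then its complement starting with [y1], [y2]: the missing
    edges fall on the pairs [i], [uphalf n + i] for [i < 2], as in [B n 2]. *)
Lemma giso_bip2 n (X : {set 'I_n}) x1 x2 y1 y2 :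
    x1 \in X -> x2 \in X -> y1 \notin X -> y2 \notin X ->
    x1 != x2 -> y1 != y2 -> #|X| = uphalf n ->
  giso (bip2 X x1 x2 y1 y2) (B n 2).
Proof.
move=> x1X x2X y1X y2X x12 y12 cX.
have [sX [uX zX mX X0 X1]] := seq_of_set2 x1 x1X x2X x12.
have [|||sY [uY zY mY Y0 Y1]] := @seq_of_set2 _ (~: X) y1 y2 x1.
- by rewrite inE.
- by rewrite inE.
- by [].
have sz : size (sX ++ sY) = n by rewrite size_cat zX zY cardsC card_ord.
have us : uniq (sX ++ sY).
  rewrite cat_uniq uX uY andbT /=; apply/hasPn => w; rewrite mY inE => /=.
  by rewrite mX.
have h2 : (2 <= uphalf n)%N.
  rewrite -cX; have <- : #|[set x1; x2]| = 2%N by rewrite cards2 x12.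
  by apply: subset_leq_card; apply/subsetP => w /set2P[] ->.
have n2 : (uphalf n + 2 <= n)%N.
  rewrite -{2}sz size_cat zX zY cX leq_add2l.
  have <- : #|[set y1; y2]| = 2%N by rewrite cards2 y12.
  by apply: subset_leq_card; apply/subsetP => w /set2P[] ->; rewrite inE.
apply: (@giso_of_seq _ _ _ _ (sX ++ sY) x1) => // [|i j]; first exact: card_ord.
set f := nth x1 (sX ++ sY).
have fX (k : 'I_n) : (f k \in X) = (k < uphalf n)%N.
  rewrite /f nth_cat zX cX; case: ltnP => hk.
    by rewrite -mX mem_nth // zX cX.
  apply/negbTE; rewrite -in_setC -mY mem_nth // zY ltn_subLR //.
  by rewrite -cX cardsC card_ord.
have fE (k : 'I_n) l v : f l = v -> (l < n)%N -> (f k == v) = (k == l :> nat).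
  by move=> <- ln; rewrite /f nth_uniq ?sz.
have f0 : f 0%N = x1 by rewrite /f nth_cat zX cX ltnW.
have f1 : f 1%N = x2 by rewrite /f nth_cat zX cX h2.
have fh : f (uphalf n) = y1 by rewrite /f nth_cat zX cX ltnn subnn.
have fh1 : f (uphalf n).+1 = y2.
  by rewrite /f nth_cat zX cX ltnNge leqnSn /= subSn // subnn.
have rE (k l : 'I_n) :
    [&& f k \in X, f l \notin X, ~~ ((f k == x1) && (f l == y1))
      & ~~ ((f k == x2) && (f l == y2))] =
    (k < uphalf n <= l)%N && ~~ ((k < 2)%N && (l == uphalf n + k :> nat)).
  rewrite !fX (fE k _ _ f0) ?(fE k _ _ f1) ?(fE l _ _ fh) ?(fE l _ _ fh1);
    by clear - h2 n2 k l; lia.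
rewrite /= /simple_rel !rE; congr (_ && _).
by rewrite /f nth_uniq ?sz.
Qed.

End BipartiteIsomorphism.

(** * Neighbourhoods in triangle-free graphs and blow-ups of the 5-cycle *)

Section Neighbourhoods.
Variables (T : finType) (G : sgraph T).

Definition nbhd v : {set T} := [set w | G v w].

Lemma nbhd_self v : v \notin nbhd v.
Proof. by rewrite inE adj_irr. Qed.

Hypothesis tf : triangle_free G.

Lemma triangle u v w : G u v -> G v w -> G u w -> False.
Proof. by move=> uv vw uw; have := tf u v w; rewrite uv vw uw. Qed.

Lemma nbhd_independent v x y : x \in nbhd v -> y \in nbhd v -> ~~ G x y.
Proof.
by rewrite !inE => vx vy; apply/negP => xy; apply: (triangle vx xy vy).
Qed.

(* A neighbour of [v] sees none of the neighbours of [v] and misses an end of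
   every edge. *)
Lemma nbhd_sub v w x y :
  w \in nbhd v -> G x y -> nbhd w \subset ~: nbhd v :\ (if G w x then y else x).
Proof.
move=> vw xy; apply/subsetP => u wu; rewrite !inE; apply/andP; split.
  rewrite inE in wu; case: ifP => [wx|/negP nwx].
    by apply/eqP => uy; apply: (triangle wx xy); rewrite -uy.
  by apply/eqP => ux; apply: nwx; rewrite -ux.
rewrite inE in wu; apply/negP => vu.
by rewrite inE in vw; apply: (triangle vw wu vu).
Qed.

Lemma card_nbhdC v x : x \notin nbhd v ->
  (#|~: nbhd v :\ x| + #|nbhd v|).+1 = #|T|.
Proof.
move=> vx; have := cardsD1 x (~: nbhd v); rewrite inE vx => /= cE.
by rewrite -(cardsC (nbhd v)) cE; lia.
Qed.

(** The end of [xy] missed by [w] lies outside the neighbourhood of [v], so it is one more vertex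
    lost to [w]. *)
Lemma card_nbhd_lt v w x y :
    w \in nbhd v -> G x y -> x \notin nbhd v -> y \notin nbhd v ->
  (#|nbhd w| + #|nbhd v| < #|T|)%N.
Proof.
move=> vw xy vx vy; have := subset_leq_card (nbhd_sub vw xy).
set z := if G w x then y else x.
have vz : z \notin nbhd v by rewrite /z; case: ifP.
by have := card_nbhdC vz; lia.
Qed.

Lemma nbhd_eq v w x y :
    w \in nbhd v -> G x y -> x \notin nbhd v -> y \notin nbhd v ->
    (#|nbhd w| + #|nbhd v|).+1 = #|T| ->
  nbhd w = ~: nbhd v :\ (if G w x then y else x).
Proof.
move=> vw xy vx vy cw; apply/eqP; rewrite eqEcard (nbhd_sub vw xy).
set z := if G w x then y else x.
have vz : z \notin nbhd v by rewrite /z; case: ifP.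
by have := card_nbhdC vz; lia.
Qed.

(** In a triangle-free graph neighbourhoods are independent, so a neighbourhood meeting every edge
    is one side of a bipartition. This is the opposite case. *)
Definition every_nbhd_misses_edge :=
  forall u, exists x y, [/\ x \notin nbhd u, y \notin nbhd u & G x y].

(* Under [tight] the graph is a blow-up of the 5-cycle: [v] and the vertices in
   [rest] form one class, [Nx] and [Ny] are two others, and the last two are
   [x] and [y] alone. *)
Variables (v x y : T).
Hypotheses (nonbip : every_nbhd_misses_edge)
  (vx : x \notin nbhd v) (vy : y \notin nbhd v) (xy : G x y)
  (v_gt0 : (0 < #|nbhd v|)%N)
  (tight : forall w, w \in nbhd v -> (#|nbhd w| + #|nbhd v|).+1 = #|T|).

Let Nx : {set T} := nbhd v :&: nbhd x.
Let Ny : {set T} := nbhd v :&: nbhd y.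
Let rest : {set T} := ~: nbhd v :\ x :\ y.

(** Otherwise a neighbour [w0] of [v] sees, by tightness, everything except [x'] and the neighbours
    of [v]. These form an independent set, while some edge avoids the neighbourhood of [w0]. *)
Lemma nbhd_meets_end x' y' : x' \notin nbhd v -> y' \notin nbhd v -> G x' y' ->
  exists2 w, w \in nbhd v & G w x'.
Proof.
move=> vx' vy' xy'; have [w0 vw0] := card_gt0P v_gt0.
have [/existsP[w /andP[]]|] := boolP [exists w, (w \in nbhd v) && G w x'].
  by exists w.
rewrite negb_exists => /forallP none.
have {}none w : w \in nbhd v -> G w x' = false.
  by move=> vw; have := none w; rewrite vw => /negPf.
have Nw0 := nbhd_eq vw0 xy' vx' vy' (tight vw0); rewrite none // in Nw0.
have [p [q [+ + pq]]] := nonbip w0; rewrite Nw0 !in_setD1 !in_setC !negb_and !negbK.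
case/predU1P=> [px|vp] /predU1P[qx|vq].
- by rewrite px qx adj_irr in pq.
- by rewrite px adj_sym none in pq.
- by rewrite qx none in pq.
- by rewrite (negPf (nbhd_independent vp vq)) in pq.
Qed.

Lemma nbhdD_Nx w : w \in nbhd v -> w \notin Nx -> w \in Ny.
Proof.
move=> vw; rewrite !in_setI vw /= !inE => nxw.
have := nbhd_eq vw xy vx vy (tight vw).
rewrite (adj_sym G w) (negPf nxw) => /setP/(_ y).
rewrite in_setD1 in_setC vy inE andbT adj_sym => ->.
by apply/eqP => yx; move: xy; rewrite yx adj_irr.
Qed.

Lemma Nx_notin_Ny w : w \in Nx -> w \notin Ny.
Proof.
rewrite !inE => /andP[vw xw]; rewrite vw /=; apply/negP => yw.
by apply: (triangle xy yw).
Qed.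

Lemma nbhd_Nx w : w \in Nx -> nbhd w = x |: rest.
Proof.
move=> wNx; have := wNx; rewrite in_setI => /andP[vw].
rewrite inE => xw; rewrite (nbhd_eq vw xy vx vy (tight vw)) adj_sym xw.
apply/setP => u; rewrite /rest !inE; case: (eqVneq u x) => [->|//] /=.
move: vx; rewrite inE => ->; rewrite andbT.
by apply/eqP => E; move: xy; rewrite E adj_irr.
Qed.

Lemma nbhd_Ny w : w \in Ny -> nbhd w = y |: rest.
Proof.
move=> wNy; have := wNy; rewrite in_setI => /andP[vw].
rewrite inE => yw; rewrite (nbhd_eq vw xy vx vy (tight vw)) adj_sym.
have -> : G x w = false.
  by apply/negP => xw; apply: (triangle xy yw).
apply/setP => u; rewrite /rest !inE; case: (eqVneq u y) => [->|//] /=.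
move: vy; rewrite inE => ->; rewrite andbT.
by apply/eqP => E; move: xy; rewrite E adj_irr.
Qed.

Lemma Nx_gt0 : (0 < #|Nx|)%N.
Proof.
have [w vw wx] := nbhd_meets_end vx vy xy.
by apply/card_gt0P; exists w; rewrite in_setI vw inE adj_sym.
Qed.

Lemma Ny_gt0 : (0 < #|Ny|)%N.
Proof.
have yx : G y x by rewrite adj_sym.
have [w vw wy] := nbhd_meets_end vy vx yx.
by apply/card_gt0P; exists w; rewrite in_setI vw inE adj_sym.
Qed.

Lemma card_Nx_Ny : (#|Nx| + #|Ny|)%N = #|nbhd v|.
Proof.
rewrite -(cardsID (nbhd x) (nbhd v)); congr (_ + _)%N; apply: eq_card => w.
apply/idP/idP => [wNy|/setDP[vw xw]]; last first.
  by apply: nbhdD_Nx => //; rewrite in_setI (negPf xw) andbF.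
have := wNy; rewrite in_setI => /andP[vw _]; rewrite in_setD vw andbT.
by apply: contraL wNy => xw; apply: Nx_notin_Ny; rewrite in_setI vw.
Qed.

Lemma card_rest : (#|rest| + #|nbhd v|).+2 = #|T|.
Proof.
have := cardsD1 y (~: nbhd v :\ x); rewrite -/rest.
have -> : y \in ~: nbhd v :\ x.
  rewrite in_setD1 in_setC vy andbT.
  by apply/eqP => E; move: xy; rewrite E adj_irr.
by have := card_nbhdC vx; lia.
Qed.

(** A vertex of [Nx] sees [x] and all of [rest], one of [Ny] sees [y] and all of [rest]; an edge
    from [u] to [x], [y] or [rest] would close a triangle with one of them. *)
Lemma rest_adj u w : u \in rest -> G u w -> w \in nbhd v.
Proof.
move=> ur uw; apply/negPn/negP => vw.
have via p w' : p \in nbhd v -> G p w' -> nbhd p = w' |: rest -> w \in nbhd p -> False.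
  move=> vp pw' pE pw; apply: (@triangle p u w) => //; last by rewrite inE in pw.
  by have : u \in nbhd p; [rewrite pE in_setU1 ur orbT | rewrite inE].
have [p pNx] := card_gt0P Nx_gt0; have [q qNy] := card_gt0P Ny_gt0.
have [vp xp] := setIP pNx; have [vq yq] := setIP qNy.
have [wx|wx] := eqVneq w x.
  apply: (via p x vp _ (nbhd_Nx pNx)); first by rewrite inE adj_sym in xp.
  by rewrite wx nbhd_Nx // setU11.
have [wy|wy] := eqVneq w y.
  apply: (via q y vq _ (nbhd_Ny qNy)); first by rewrite inE adj_sym in yq.
  by rewrite wy nbhd_Ny // setU11.
apply: (via p x vp _ (nbhd_Nx pNx)); first by rewrite inE adj_sym in xp.
by rewrite nbhd_Nx // /rest in_setU1 !in_setD1 in_setC vw wx wy orbT.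
Qed.

Lemma nbhd_x_sub : nbhd x \subset y |: Nx.
Proof.
apply/subsetP => u xu; rewrite in_setU1 in_setI xu andbT.
have [//|uy] := eqVneq u y; apply/negPn/negP => /= vu.
have ur : u \in rest.
  rewrite /rest !in_setD1 in_setC uy vu andbT /=.
  by apply: contraNneq (nbhd_self x) => E; rewrite -{1}E.
by rewrite inE adj_sym in xu; move: vx; rewrite (rest_adj ur xu).
Qed.

Lemma nbhd_y_sub : nbhd y \subset x |: Ny.
Proof.
apply/subsetP => u yu; rewrite in_setU1 in_setI yu andbT.
have [//|ux] := eqVneq u x; apply/negPn/negP => /= vu.
have ur : u \in rest.
  rewrite /rest !in_setD1 in_setC ux vu andbT /= andbT.
  by apply: contraNneq (nbhd_self y) => E; rewrite -{1}E.
by rewrite inE adj_sym in yu; move: vy; rewrite (rest_adj ur yu).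
Qed.

(** The weight takes the values [p], [q], [r], [s], [m] on [Nx], [Ny], [x], [y], [rest]; the five
    inequalities are the condition of [eigen_le] on these classes. *)
Lemma c5_blowup_eigen_le (R : realType) (p q r s m c t : R) f :
    0 < p -> 0 < q -> 0 < r -> 0 < s -> 0 < m ->
    #|Nx|%:R * p + #|Ny|%:R * q <= c * m ->
    #|rest|%:R * m + r <= c * p -> #|rest|%:R * m + s <= c * q ->
    #|Nx|%:R * p + s <= c * r -> #|Ny|%:R * q + r <= c * s ->
  eigenfun G t f -> `|t| <= c.
Proof.
move=> p0 q0 r0 s0 m0 Hm Hp Hq Hr Hs.
pose z u := if u \in Nx then p else if u \in Ny then q else
  if u == x then r else if u == y then s else m.
have z0 u : 0 < z u by rewrite /z; do 4?case: ifP => _.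
have sum_le (A : {set T}) u : nbhd u \subset A ->
    nbsum G z u <= \sum_(w in A) z w.
  move=> /subsetP uA.
  apply: (nbsum_subrel (e' := fun _ w => w \in A)) => w; first by rewrite ltW.
  by move=> uw; apply: uA; rewrite inE.
have xn : x \notin Nx by rewrite in_setI (negPf vx).
have xn' : x \notin Ny by rewrite in_setI (negPf vx).
have yn : y \notin Nx by rewrite in_setI (negPf vy).
have yn' : y \notin Ny by rewrite in_setI (negPf vy).
have yx : y != x by apply/eqP => E; move: xy; rewrite E adj_irr.
have zx : z x = r by rewrite /z (negPf xn) (negPf xn') eqxx.
have zy : z y = s by rewrite /z (negPf yn) (negPf yn') (negPf yx) eqxx.
have sumNx : \sum_(w in Nx) z w = #|Nx|%:R * p.
  by rewrite mulr_natl -sumr_const; apply: eq_bigr => w; rewrite /z => ->.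
have zNy w : w \in Ny -> z w = q.
  move=> wNy; rewrite /z wNy; case: ifP => // /Nx_notin_Ny.
  by rewrite wNy.
have sumNy : \sum_(w in Ny) z w = #|Ny|%:R * q.
  by rewrite mulr_natl -sumr_const; apply: eq_bigr => w /zNy.
have zrest w : w \in rest -> z w = m.
  rewrite /rest !in_setD1 in_setC => /and3P[wy wx vw].
  by rewrite /z !in_setI (negPf vw) (negPf wx) (negPf wy).
have sumrest : \sum_(w in rest) z w = #|rest|%:R * m.
  by rewrite mulr_natl -sumr_const; apply: eq_bigr => w /zrest.
have xr : x \notin rest by rewrite /rest !in_setD1 eqxx andbF.
have yr : y \notin rest by rewrite /rest !in_setD1 eqxx.
apply: (@eigen_le _ _ _ _ _ z) => // u.
have [uNx|uNx] := boolP (u \in Nx).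
  have := sum_le (x |: rest) u; rewrite nbhd_Nx // => /(_ (subxx _)).
  rewrite big_setU1 //= sumrest zx /z uNx; lra.
have [uNy|uNy] := boolP (u \in Ny).
  have := sum_le (y |: rest) u; rewrite nbhd_Ny // => /(_ (subxx _)).
  rewrite big_setU1 //= sumrest zy zNy //; lra.
have [->|ux] := eqVneq u x.
  have := sum_le _ _ nbhd_x_sub; rewrite big_setU1 //= sumNx zx zy; lra.
have [->|uy] := eqVneq u y.
  have := sum_le _ _ nbhd_y_sub; rewrite big_setU1 //= sumNy zx zy; lra.
have ur : u \in rest.
  rewrite /rest !in_setD1 uy ux in_setC /=.
  by apply: contra uNx => vu; apply: contraNT uNy => /(nbhdD_Nx vu).
have sub : nbhd u \subset nbhd v.
  by apply/subsetP => w; rewrite inE; apply: rest_adj.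
have := sum_le _ _ sub; rewrite (big_setID (nbhd x)) /= -/Nx sumNx zrest //.
have -> : nbhd v :\: nbhd x = Ny.
  apply/setP => w; apply/idP/idP => [/setDP[vw xw]|wNy].
    by apply: nbhdD_Nx => //; rewrite in_setI (negPf xw) andbF.
  have [vw _] := setIP wNy; rewrite in_setD vw andbT.
  by apply: contraL wNy => xw; apply: Nx_notin_Ny; rewrite in_setI vw.
by rewrite sumNy; lra.
Qed.

End Neighbourhoods.

(** * Walks of length two *)

Section Walks.

(** Applied twice to the constant weight 1, the neighbour sum counts the walks of length two from
    [v]. *)
Lemma eigen_sqr_le_walks (T : finType) (G : sgraph T) (R : realType) K (t : R) f :
    (forall v, (\sum_(w in nbhd G v) #|nbhd G w| <= K)%N) ->
  eigenfun G t f -> t ^+ 2 <= K%:R.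
Proof.
move=> wK; apply: (@eigen_sqr_le _ _ _ _ _ (fun=> 1)) => // v.
rewrite mulr1; apply: le_trans (_ : (\sum_(w in nbhd G v) #|nbhd G w|)%:R <= _).
  rewrite natr_sum /nbsum le_eqVlt; apply/orP; left; apply/eqP.
  apply: eq_big => [w|w _]; first by rewrite inE.
  by rewrite sumr_const; congr (_ *+ _); apply: eq_card => u; rewrite inE.
by rewrite ler_nat.
Qed.

Lemma sqr_lt_sqrt (R : realType) (t l : R) : t ^+ 2 < l -> t < Num.sqrt l.
Proof.
move=> tl; have l0 : 0 <= l by apply: le_trans (ltW tl); apply: sqr_ge0.
rewrite ltNge; apply: contraL tl => lt; rewrite -leNgt -(sqr_sqrtr l0).
by rewrite ler_pXn2r // ?nnegrE ?sqrtr_ge0 // (le_trans _ lt) ?sqrtr_ge0.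
Qed.

Lemma sum_max_eq (T : finType) (A : {set T}) (f : T -> nat) k :
    (forall w, w \in A -> f w <= k)%N -> (#|A| * k <= \sum_(w in A) f w)%N ->
  forall w, w \in A -> f w = k.
Proof.
move=> fk sumk w wA; apply/eqP; rewrite eqn_leq fk //=.
move: sumk; rewrite (bigD1 w) //= (cardsD1 w) wA mulnDl mul1n.
suff : (\sum_(i in A | i != w) f i <= #|A :\ w| * k)%N by lia.
rewrite -sum_nat_const (eq_bigl (mem (A :\ w))) => [|i]; last first.
  by rewrite /= !inE andbC.
by apply: leq_sum => i /setD1P[_ /fk].
Qed.

End Walks.

(** * Graphs in which every neighbourhood misses an edge *)

Section NonBipartite.
Variables (R : realType) (n : nat) (G : graph n).
Hypotheses (n6 : (6 <= n)%N) (tf : triangle_free G)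
  (nonbip : every_nbhd_misses_edge G).

Let walks v := (\sum_(w in nbhd G v) #|nbhd G w|)%N.

Lemma nbhd_bound v w : w \in nbhd G v ->
  (#|nbhd G w| <= n - #|nbhd G v| - 1)%N.
Proof.
move=> vw; have [x [y [vx vy xy]]] := nonbip v.
by have := card_nbhd_lt tf vw xy vx vy; rewrite card_ord; lia.
Qed.

Lemma walks_le v : (walks v <= #|nbhd G v| * (n - #|nbhd G v| - 1))%N.
Proof. by rewrite -sum_nat_const; apply: leq_sum => w /nbhd_bound. Qed.

Lemma eigen_lt_of_walks (t : R) f k : (4 * k <= n.-1 ^ 2)%N ->
    (n = 6 -> k <= 5)%N -> (n = 7 -> k <= 8)%N ->
    (forall v, walks v <= k)%N ->
  eigenfun G t f -> t < Num.sqrt (bigroot (uphalf n)%:R (n./2)%:R).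
Proof.
move=> kn k6 k7 wk ex; apply: sqr_lt_sqrt.
by apply: le_lt_trans (eigen_sqr_le_walks wk ex) _; apply: nat_lt_bigroot.
Qed.

Lemma sqrt_bigroot_gt (c d c' d' l : R) : c = c' -> d = d' -> 3 <= c -> 3 <= d ->
  0 <= l -> quad c d (l ^+ 2) < 0 -> l < Num.sqrt (bigroot c' d').
Proof.
by move=> <- <- c3 d3 l0 ql; apply: sqr_lt_sqrt; apply: lt_bigroot.
Qed.

(* The weights approximate the Perron vectors of the blow-ups, whose spectral
   radii are about 2.392 ([n = 6]) and 2.903 ([n = 7]). *)
Lemma tight_eigen_le (t : R) f v : eigenfun G t f ->
    (#|nbhd G v| * (n - #|nbhd G v| - 1) <= walks v)%N -> (0 < walks v)%N ->
  (n = 6%N -> (6 <= walks v)%N -> t <= 12 / 5) /\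
  (n = 7%N -> (9 <= walks v)%N -> t <= 59 / 20).
Proof.
move=> ex wv w0; have [x [y [vx vy xy]]] := nonbip v.
have v0 : (0 < #|nbhd G v|)%N.
  rewrite lt0n; apply: contraTneq w0 => /cards0_eq v0.
  by rewrite /walks v0 big_set0.
(* The walk count attains [d (n - 1 - d)], so every neighbour of [v] attains its degree bound. *)
have dn w : w \in nbhd G v -> (#|nbhd G w| + #|nbhd G v|).+1 = n.
  move=> vw; have := sum_max_eq (@nbhd_bound v) wv vw.
  by have := card_nbhd_lt tf vw xy vx vy; rewrite card_ord; lia.
have tight w : w \in nbhd G v -> (#|nbhd G w| + #|nbhd G v|).+1 = #|'I_n|.
  by rewrite card_ord; apply: dn.
have := Nx_gt0 tf nonbip vx vy xy v0 tight.
have := Ny_gt0 tf nonbip vx vy xy v0 tight.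
have := card_Nx_Ny tf vx vy xy tight.
have := card_rest vx vy xy v0; rewrite card_ord.
have := fun p q r s m c => @c5_blowup_eigen_le _ _ tf _ _ _ nonbip vx vy xy v0
  tight R p q r s m c t f.
have := walks_le v.
set Nx := #|_ :&: nbhd G x|; set Ny := #|_ :&: nbhd G y|; set S := #|_ :\ _|.
move=> wle main cS cN Ny0 Nx0.
split=> nE wge; apply: le_trans (ler_norm _) _.
  (* Only [d = 2] and [d = 3] give [d (5 - d) >= 6]; each case is the 5-cycle with one vertex
     doubled. *)
  have [[d S1]|[d S2]] : (#|nbhd G v| = 3 /\ S = 1 \/ #|nbhd G v| = 2 /\ S = 2)%N.
    move: #|nbhd G v| (walks v) wle cS wge => d W; rewrite nE.
    by move: d => [|[|[|[|[|[|d]]]]]] /=; lia.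
  - have [[X1 Y1]|[X1 Y1]] : (Nx = 2 /\ Ny = 1 \/ Nx = 1 /\ Ny = 2)%N by lia.
      apply: (main 117 100 140 100 140); rewrite ?X1 ?Y1 ?S1 //; lra.
    apply: (main 100 117 100 140 140); rewrite ?X1 ?Y1 ?S1 //; lra.
  - have [X1 Y1] : (Nx = 1 /\ Ny = 1)%N by lia.
    apply: (main 140 140 100 100 117); rewrite ?X1 ?Y1 ?S2 //; lra.
(* Only [d = 3] gives [d (6 - d) >= 9]; two adjacent vertices of the 5-cycle are doubled. *)
have [d S2] : (#|nbhd G v| = 3 /\ S = 2)%N.
  move: #|nbhd G v| (walks v) wle cS wge => d W; rewrite nE.
  by move: d => [|[|[|[|[|[|[|d]]]]]]] /=; lia.
have [[X1 Y1]|[X1 Y1]] : (Nx = 2 /\ Ny = 1 \/ Nx = 1 /\ Ny = 2)%N by lia.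
  apply: (main 100 95 95 70 100); rewrite ?X1 ?Y1 ?S2 //; lra.
apply: (main 95 100 70 95 100); rewrite ?X1 ?Y1 ?S2 //; lra.
Qed.

(** The walk count suffices unless [n] is 6 or 7 and some vertex starts 6, respectively 9, walks;
    such a vertex makes [G] a blow-up of the 5-cycle. *)
Lemma nonbip_eigen_lt (t : R) f : eigenfun G t f ->
  t < Num.sqrt (bigroot (uphalf n)%:R (n./2)%:R).
Proof.
move=> ex; have wle := walks_le.
have wle2 v : (4 * walks v <= n.-1 ^ 2)%N.
  (* For [d >= n] truncated subtraction makes the product zero; otherwise its factors sum to [n - 1]
     and the inequality of means applies. *)
  have := wle v; move: #|_| => d; have [dn|nd] := ltnP d n; last first.
    have -> : (n - d - 1 = 0)%N by lia.
    by rewrite muln0 leqn0 => /eqP ->; rewrite muln0.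
  have := nat_AGM2 d (n - d - 1); have -> : (d + (n - d - 1) = n.-1)%N by lia.
  by move=> agm wd; apply: leq_trans agm; rewrite leq_mul2l.
have [[v wv]|small] := pselect (exists v,
    (n = 6 /\ 6 <= walks v \/ n = 7 /\ 9 <= walks v)%N).
  (* 6 and 9 are the maxima of [d (5 - d)] and [d (6 - d)]. *)
  have wd : (#|nbhd G v| * (n - #|nbhd G v| - 1) <= walks v)%N.
    move: #|nbhd G v| (walks v) wv => d W [[-> ?]|[-> ?]];
      by move: d => [|[|[|[|[|[|[|d]]]]]]]; lia.
  have w0 : (0 < walks v)%N by lia.
  have [t6 t7] := tight_eigen_le ex wd w0.
  case: wv => -[nE wv].
    apply: le_lt_trans (t6 nE wv) _.
    (* The square of 12/5 is 5.76, below 5.83; for [n = 7] the square of 59/20 is 8.7025, below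
       8.77. *)
    by apply: (@sqrt_bigroot_gt 3 3); rewrite ?nE // /quad; lra.
  apply: le_lt_trans (t7 nE wv) _.
  by apply: (@sqrt_bigroot_gt 4 3); rewrite ?nE // /quad; lra.
have nwalks v : ((n = 6 -> walks v <= 5) /\ (n = 7 -> walks v <= 8))%N.
  split=> nE; rewrite leqNgt; apply/negP => wv; apply: small; exists v; lia.
have [k kE] : exists k,
    k = (if n == 6 then 5 else if n == 7 then 8 else n.-1 ^ 2 %/ 4)%N.
  by eexists.
apply: (@eigen_lt_of_walks _ _ k) ex; rewrite kE.
- case: eqP => [->//|_]; case: eqP => [->//|_].
  by rewrite mulnC leq_divM.
- by move=> ->.
- by move=> ->.
move=> v; have [w6 w7] := nwalks v; case: eqP => [/w6//|_]; case: eqP => [/w7//|_].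
by rewrite leq_divRL // mulnC.
Qed.

End NonBipartite.

(** * Disjoint non-edges across a vertex partition *)

Section Bipartite.

Lemma connect_cross (T : finType) (e : rel T) (X : {set T}) u w :
  connect e u w -> u \in X -> w \notin X ->
  exists a b, [/\ e a b, a \in X & b \notin X].
Proof.
case/connectP=> p; elim: p u => [|c p IH] u /=; first by move=> _ -> ->.
case/andP=> uc pc wE uX wX; have [cX|cX] := boolP (c \in X); first exact: IH pc _ _ _.
by exists u, c.
Qed.

Variables (T : finType) (G : sgraph T) (X : {set T}).
Hypotheses (T_gt2 : (2 < #|T|)%N) (kG : (2 <= kappa (complement G))%N).

(** The complement graph stays connected without [v], so some path in it leaves [X], and its
    crossing step is a non-edge of [G]. *)
Lemma nonadj_across v : X :\ v != set0 -> ~: X :\ v != set0 ->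
  exists x y, [/\ x \in X, y \notin X, ~~ G x y, x != v & y != v].
Proof.
case/set0Pn=> u /setD1P[uv uX] /set0Pn[w /setD1P[wv]]; rewrite inE => wX.
have := elimT (kappa_ge2P _ T_gt2) kG v u w uv wv.
case/connect_cross/(_ uX wX) => a [b [/and3P[av bv ab] aX bX]].
rewrite !inE in av bv; exists a, b; split=> //.
by move: ab; rewrite /= /simple_rel [G b a]adj_sym orbb => /andP[].
Qed.

(** Take a non-edge [x1 y1], then one avoiding [x1]. If both end in [y1], a third one avoiding [y1]
    is disjoint from one of the two. *)
Lemma two_disjoint_nonadj : (2 <= #|X|)%N -> (2 <= #|~: X|)%N ->
  exists x1 x2 y1 y2, [/\ x1 \in X, x2 \in X, y1 \notin X & y2 \notin X] /\
    [/\ x1 != x2, y1 != y2, ~~ G x1 y1 & ~~ G x2 y2].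
Proof.
move=> X2 Y2.
have ne (Y : {set T}) v : (2 <= #|Y|)%N -> Y :\ v != set0.
  by rewrite -card_gt0 (cardsD1 v); case: (v \in Y) => /=; lia.
have cross v := nonadj_across (ne X v X2) (ne (~: X) v Y2).
have /set0Pn[v _] : X != set0 by rewrite -card_gt0 (leq_trans _ X2).
have [x1 [y1 [x1X y1X n11 _ _]]] := cross v.
have [x2 [y [x2X yX n2 x21 _]]] := cross x1.
have [yE|yy1] := eqVneq y y1; last first.
  by exists x1, x2, y1, y; do !split=> //; rewrite eq_sym.
rewrite {}yE in n2.
have [x [y2 [xX y2X nx2 _ y21]]] := cross y1.
have [xE|xx1] := eqVneq x x1; last first.
  by exists x1, x, y1, y2; do !split=> //; rewrite eq_sym.
by exists x2, x1, y1, y2; do !split=> //; rewrite -?xE // eq_sym.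
Qed.

End Bipartite.

Lemma balanced_or_mul_lt p q a b : (q <= p <= q.+1)%N -> (a + b = p + q)%N ->
  (a = p \/ b = p \/ a * b + 1 <= p * q)%N.
Proof.
wlog ab : a b / (a <= b)%N => [hw|].
  have [/hw//|/ltnW/hw h] := leqP a b; move=> pq; rewrite addnC mulnC.
  by move=> /(h pq); tauto.
(* With this [k], [p q - a b = k (p - a)], and [p - a >= k]. *)
case/andP=> qp pq sum; have [k qE] : exists k, q = (a + k)%N.
  by exists (q - a)%N; lia.
have bE : b = (p + k)%N by lia.
case: k qE bE => [|k] qE bE; first by right; left; lia.
by right; right; rewrite qE bE; nia.
Qed.

Lemma uphalf_add_half n : (uphalf n + n./2)%N = n.
Proof. by rewrite uphalf_half -addnA addnn odd_double_half. Qed.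

Lemma half_le_uphalf n : (n./2 <= uphalf n <= n./2.+1)%N.
Proof. by rewrite uphalf_half; case: (odd n); rewrite ?add1n ?add0n leqnn leqnSn. Qed.

Lemma half_ge3 n : (6 <= n)%N -> (3 <= uphalf n)%N /\ (3 <= n./2)%N.
Proof.
move=> n6; have h3 : (3 <= n./2)%N := half_leq n6.
by split=> //; have /andP[/(leq_trans h3)] := half_le_uphalf n.
Qed.

(** * The bipartite case and the dichotomy for family members *)

Section BipartiteCase.
Variables (R : realType) (n : nat) (G : graph n).
Hypotheses (n6 : (6 <= n)%N) (kG : (2 <= kappa (complement G))%N).

Let r : R := Num.sqrt (bigroot (uphalf n)%:R (n./2)%:R).

Lemma n_gt2 : (2 < #|'I_n|)%N.
Proof. by rewrite card_ord; lia. Qed.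

(** The neighbours of [v] lie in the opposite part, and theirs in the part of [v]. *)
Lemma bip_walks_le (X : {set 'I_n}) v :
    (forall u w, G u w -> (u \in X) != (w \in X)) ->
  (\sum_(w in nbhd G v) #|nbhd G w| <= #|X| * #|~: X|)%N.
Proof.
move=> bip.
have sub u : nbhd G u \subset if u \in X then ~: X else X.
  apply/subsetP => w; rewrite inE => /bip.
  by case: ifP; rewrite ?inE; case: (w \in X).
have le_sub w : w \in nbhd G v -> (#|nbhd G w| <= #|if v \in X then X else ~: X|)%N.
  rewrite inE => /bip vw; apply: leq_trans (subset_leq_card (sub w)) _.
  by case: (v \in X) (w \in X) vw => -[].
apply: (@leq_trans (\sum_(w in nbhd G v) #|if v \in X then X else ~: X|)).
  by apply: leq_sum => w /le_sub.
rewrite sum_nat_const.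
have := subset_leq_card (sub v); case: ifP => _ vs.
  by rewrite mulnC leq_mul2l vs orbT.
by rewrite leq_mul2r vs orbT.
Qed.

Lemma balanced_case (X : {set 'I_n}) x1 x2 y1 y2 :
    #|X| = uphalf n ->
    x1 \in X -> x2 \in X -> y1 \notin X -> y2 \notin X ->
    x1 != x2 -> y1 != y2 ->
    (forall u w, G u w -> bip2 X x1 x2 y1 y2 u w) ->
  giso G (B n 2) \/ forall t f, eigenfun G t f -> t < r.
Proof.
move=> cX x1X x2X y1X y2X x12 y12 sG.
have cY : #|~: X| = n./2.
  have := cardsC X; rewrite card_ord cX -[RHS]uphalf_add_half.
  exact: addnI.
have [a3 b3] : (3 <= #|X|)%N /\ (3 <= #|~: X|)%N.
  by rewrite cX cY; apply: half_ge3.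
have [GE|lt] := bip2_sub_eigen_lt R x1X x2X y1X y2X x12 y12 a3 b3 sG; last first.
  by right=> t f /lt; rewrite cX cY.
left; apply: giso_trans (giso_bip2 x1X x2X y1X y2X x12 y12 cX).
by exists id => [|u w]; [exists id | rewrite GE].
Qed.

Lemma bipartite_case (X : {set 'I_n}) :
    (forall u w, G u w -> (u \in X) != (w \in X)) ->
  giso G (B n 2) \/ forall t f, eigenfun G t f -> t < r.
Proof.
move=> bip; have cXY : (#|X| + #|~: X| = n)%N by rewrite cardsC card_ord.
have [/andP[X2 Y2]|small] := boolP ((2 <= #|X|) && (2 <= #|~: X|))%N; last first.
  (* With a part of at most one vertex, counting walks is enough. *)
  have ab : (#|X| * #|~: X| <= n - 1)%N.
    by move: cXY small; case: #|X| => [|[|a]]; case: #|~: X| => [|[|b]]; nia.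
  right=> t f ex; apply: sqr_lt_sqrt.
  apply: le_lt_trans (eigen_sqr_le_walks (fun v => bip_walks_le v bip) ex) _.
  apply: nat_lt_bigroot => //; [|lia|lia].
  have : (4 * (n - 1) <= n.-1 ^ 2)%N by rewrite -subn1; nia.
  by lia.
have [x1 [x2 [y1 [y2 [[x1X x2X y1X y2X] [x12 y12 n1 n2]]]]]] :=
  two_disjoint_nonadj n_gt2 kG X2 Y2.
have sG u w : G u w -> bip2 X x1 x2 y1 y2 u w.
  move=> uw; have := bip _ _ uw.
  case: (boolP (u \in X)) => uX wX.
    rewrite bip2_l //; have -> /= : w \notin X by case: (w \in X) wX.
    apply/andP; split; apply/negP => /andP[/eqP ux /eqP wy].
      by move: uw; rewrite ux wy (negPf n1).
    by move: uw; rewrite ux wy (negPf n2).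
  rewrite bip2_r //; have -> /= : w \in X by case: (w \in X) wX.
  rewrite adj_sym in uw; apply/andP; split; apply/negP => /andP[/eqP ux /eqP wy].
    by move: uw; rewrite ux wy (negPf n1).
  by move: uw; rewrite ux wy (negPf n2).
have [h3 k3] := half_ge3 n6.
have [cX|[cY|lt]] : (#|X| = uphalf n \/ #|~: X| = uphalf n \/
    #|X| * #|~: X| + 1 <= uphalf n * n./2)%N.
- by apply: balanced_or_mul_lt; rewrite ?half_le_uphalf ?uphalf_add_half.
- exact: balanced_case cX x1X x2X y1X y2X x12 y12 sG.
(* The complement has size [uphalf n] here, so the parts exchange roles. *)
- apply: (balanced_case (X := ~: X) (x1 := y1) (x2 := y2) (y1 := x1) (y2 := x2)) => //;
    rewrite ?inE ?negbK //.
  by move=> u w /sG; rewrite bip2C.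
right=> t f ex; have aR : 2 <= #|X|%:R :> R by rewrite ler_nat.
have bR : 2 <= #|~: X|%:R :> R by rewrite ler_nat.
apply: le_lt_trans (ler_norm _) _.
(* At [l = a b - 3] the value of [quad] is [(a - 2) (b - 2)], which is nonnegative. *)
apply: (@le_lt_trans _ _ (Num.sqrt (#|X|%:R * #|~: X|%:R - 3))).
  apply: (bip2_eigen_le x1X x2X y1X y2X x12 y12 _ _ _ sG ex).
  - nra.
  - nra.
  rewrite /quad -expr2 subrr add0r mulr_ge0 //; lra.
have {}h3 : 3 <= (uphalf n)%:R :> R by rewrite ler_nat.
have {}k3 : 3 <= (n./2)%:R :> R by rewrite ler_nat.
rewrite ltr_sqrt; last by have := bigroot_ge1 h3 k3; lra.
apply: unbalanced_lt_bigroot => //; last by rewrite -!natrM natr1 ler_nat -addn1.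
by rewrite -!natrD cXY uphalf_add_half.
Qed.

Lemma family_case : triangle_free G ->
  giso G (B n 2) \/ forall t f, eigenfun G t f -> t < r.
Proof.
move=> tf; have [nonbip|[v vind]] : every_nbhd_misses_edge G \/
    exists v, forall x y, G x y -> (x \in nbhd G v) || (y \in nbhd G v).
- have [[v vind]|nind] := pselect (exists v, forall x y, G x y ->
      (x \in nbhd G v) || (y \in nbhd G v)); first by right; exists v.
  left=> u; have [//|none] := pselect (exists x y,
    [/\ x \notin nbhd G u, y \notin nbhd G u & G x y]).
  case: nind; exists u => x y xy; apply/negPn/negP; rewrite negb_or => /andP[ux uy].
  by apply: none; exists x, y.
- by right=> t f; apply: nonbip_eigen_lt.
apply: (bipartite_case (X := nbhd G v)) => u w uw; have := vind _ _ uw.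
case: (boolP (u \in nbhd G v)) => vu /=; last by move=> ->.
case: (boolP (w \in nbhd G v)) => // vw.
by move: uw; rewrite (negPf (nbhd_independent tf vu vw)).
Qed.

End BipartiteCase.

(** * Membership and spectral radius of [B n 2] *)

Section BFamily.
Variables (R : realType) (n : nat).
Hypothesis n6 : (6 <= n)%N.

Lemma B_l (i j : 'I_n) : (i < uphalf n)%N ->
  B n 2 i j = (uphalf n <= j)%N && ~~ ((i < 2)%N && (j == uphalf n + i :> nat)%N).
Proof.
move=> ih; rewrite /B /= /simple_rel ih /= [(uphalf n <= i)%N]leqNgt ih andbF /= orbF.
by have [ij|//] := eqVneq i j; rewrite -ij leqNgt ih.
Qed.

Lemma B_same (i j : 'I_n) : (i < uphalf n)%N = (j < uphalf n)%N -> B n 2 i j = false.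
Proof.
rewrite /B /= /simple_rel => ij; rewrite ![(uphalf n <= _)%N]leqNgt -ij.
by case: (i < uphalf n)%N; rewrite /= !andbF.
Qed.

Lemma B_triangle_free : triangle_free (B n 2).
Proof.
have sides i j : B n 2 i j -> (i < uphalf n)%N != (j < uphalf n)%N.
  by apply: contraTneq => /B_same ->.
move=> x y z; apply/negP => /and3P[/sides + /sides + /sides].
by case: (x < _)%N; case: (y < _)%N; case: (z < _)%N.
Qed.

(** The complement consists of two cliques joined by two disjoint edges; deleting [v] spares one of
    them, [l m], through which every vertex reaches [l]. *)
Lemma B_kappa : (2 <= kappa (complement (B n 2)))%N.
Proof.
apply/kappa_ge2P; first by rewrite card_ord; lia.
move=> v x y xv yv; set h := uphalf n.
have hn : (h + 2 < n)%N by rewrite /h; lia.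
have h2 : (2 < h)%N by rewrite /h; lia.
have compl i j : i != j -> ~~ B n 2 i j -> complement (B n 2) i j.
  move=> ij nB.
  by rewrite -[complement _ _ _]/((i != j) && (~~ B n 2 i j || ~~ B n 2 j i)) ij nB.
have [l [m [lh mh lv mv nlm]]] : exists l m : 'I_n,
    [/\ (l < h)%N, (h <= m)%N, l != v, m != v & ~~ B n 2 l m].
  have nB (i : nat) (ih : (i < n)%N) (jh : (h + i < n)%N) : (i < 2)%N ->
      ~~ B n 2 (Ordinal ih) (Ordinal jh).
    move=> i2; rewrite B_l /=; last by rewrite -/h; lia.
    by rewrite i2 eqxx andbF.
  have l0 : (0 < n)%N by lia. have m0 : (h + 0 < n)%N by lia.
  have l1 : (1 < n)%N by lia. have m1 : (h + 1 < n)%N by lia.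
  have [v01|v01] := boolP ((v == 0 :> nat) || (v == h :> nat))%N.
    exists (Ordinal l1), (Ordinal m1); split; rewrite ?nB //= -?val_eqE /=; try lia.
  exists (Ordinal l0), (Ordinal m0); split; rewrite ?nB //= -?val_eqE /=; try lia.
pose e := deleted_rel (complement (B n 2)) [set v].
have eP i j : i != v -> j != v -> i != j -> ~~ B n 2 i j -> e i j.
  by move=> iv jv ij nB; rewrite /e /deleted_rel !inE iv jv compl.
have to_l u : u != v -> connect e u l.
  move=> uv; have lm : m != l by apply: contraTneq mh => ->; rewrite -ltnNge.
  have ml : connect e m l by apply/connect1/eP => //; rewrite adj_sym.
  have [uh|uh] := boolP (u < h)%N.
    have [->|ul] := eqVneq u l; first exact: connect0.
    by apply/connect1/eP => //; rewrite B_same // -/h uh lh.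
  have [->|um] := eqVneq u m; first exact: ml.
  apply: connect_trans ml; apply/connect1/eP => //.
  by rewrite B_same // -/h (negPf uh) ltnNge mh.
apply: connect_trans (to_l x xv) _.
by rewrite (sym_connect_sym (deleted_sym _ _)); apply: to_l.
Qed.

Lemma B_family : @spex_family n 2 (B n 2).
Proof. by split; [exact: B_triangle_free | exact: B_kappa]. Qed.

Lemma rho_B : rho R (B n 2) = Num.sqrt (bigroot (uphalf n)%:R (n./2)%:R).
Proof.
pose X : {set 'I_n} := [set i : 'I_n | (i < uphalf n)%N].
have hn : (uphalf n + 2 < n)%N by lia.
have h2 : (2 < uphalf n)%N by lia.
have l0 : (0 < n)%N by lia. have m0 : (uphalf n < n)%N by lia.
have l1 : (1 < n)%N by lia. have m1 : ((uphalf n).+1 < n)%N by lia.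
have inj : injective (widen_ord (ltnW m0)).
  by move=> a b /(congr1 val) /= ab; apply: val_inj.
have cX : #|X| = uphalf n.
  rewrite -[RHS]card_ord -(card_imset _ inj).
  apply: eq_card => i; rewrite inE; apply/idP/imsetP => [ih|[j _ ->]] /=.
    by exists (Ordinal ih) => //; apply: val_inj.
  exact: ltn_ord.
have cY : #|~: X| = n./2.
  have := cardsC X; rewrite card_ord cX -[RHS]uphalf_add_half.
  exact: addnI.
have x1X : Ordinal l0 \in X by rewrite inE /=; lia.
have x2X : Ordinal l1 \in X by rewrite inE /=; lia.
have y1X : Ordinal m0 \notin X by rewrite inE /=; lia.
have y2X : Ordinal m1 \notin X by rewrite inE /=; lia.
have x12 : Ordinal l0 != Ordinal l1 by [].
have y12 : Ordinal m0 != Ordinal m1 by rewrite -val_eqE /=; lia.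
rewrite -(rho_giso R (giso_bip2 x1X x2X y1X y2X x12 y12 cX)).
have -> : bigroot (uphalf n)%:R (n./2)%:R = bigroot #|X|%:R #|~: X|%:R :> R.
  by rewrite cX cY.
have [a3 b3] : (3 <= #|X|)%N /\ (3 <= #|~: X|)%N.
  by rewrite cX cY; apply: half_ge3.
apply: rho_eq (bip2_eigenfun R x1X x2X y1X y2X x12 y12 a3 b3) _.
  exact: sqrtr_ge0.
move=> t f ex.
by apply: (bip2_sub_eigen_le x1X x2X y1X y2X x12 y12 a3 b3 _ ex).
Qed.

Lemma family_giso_or_lt (G : graph n) :
  @spex_family n 2 G -> giso G (B n 2) \/ rho R G < rho R (B n 2).
Proof.
case=> tf kG; have [|lt] := family_case R n6 kG tf; [by left | right].
rewrite rho_B; apply: rho_lt => //; rewrite sqrtr_gt0.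
have [h3 k3] := half_ge3 n6.
have {}h3 : 3 <= (uphalf n)%:R :> R by rewrite ler_nat.
have {}k3 : 3 <= (n./2)%:R :> R by rewrite ler_nat.
by have := bigroot_ge1 h3 k3; lra.
Qed.

End BFamily.

(** * Extremality criterion, degree bound, order three and matchings *)

Section ExtremalGraphs.
Variable R : realType.

Lemma family_giso n (G H : graph n) : (2 < n)%N -> giso G H ->
  @spex_family n 2 G -> @spex_family n 2 H.
Proof.
move=> n2 GH [tf kG]; split; last first.
  by apply: kappa_ge2_giso GH kG; rewrite card_ord.
have [f _ fE] := giso_sym GH => x y z.
by rewrite -!fE; apply: tf.
Qed.

Lemma spex_kappa_eq n (X : graph n) : @spex_family n 2 X ->
  (forall G, @spex_family n 2 G -> rho R G <= rho R X) ->
  spex_kappa R n 2 = rho R X.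
Proof.
move=> fX maxX; apply/eqP; rewrite eq_le; apply/andP; split.
  by apply: ge_sup => [|_ /= [G fG <-]]; [exists (rho R X), X | apply: maxX].
apply: ub_le_sup; last by exists X.
by exists (rho R X) => _ /= [G fG <-]; apply: maxX.
Qed.

Lemma unique_extremal_of n (X : graph n) : (2 < n)%N -> @spex_family n 2 X ->
    (forall G, @spex_family n 2 G -> giso G X \/ rho R G < rho R X) ->
  unique_extremal R 2 X /\ spex_kappa R n 2 = rho R X.
Proof.
move=> n2 fX alt.
have maxX G : @spex_family n 2 G -> rho R G <= rho R X.
  by case/alt => [/rho_giso -> //|/ltW].
split; last exact: spex_kappa_eq.
move=> G; split=> [[/alt[//|lt] /(_ X fX)]|GX].
  by rewrite leNgt lt.
split; first exact: family_giso (giso_sym GX) fX.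
by move=> H /maxX; rewrite (rho_giso R GX).
Qed.

(** In the complement graph [u] keeps a neighbour after any other vertex is deleted; deleting the
    first one found yields the second. *)
Lemma nonadj2 n (G : graph n) u : (2 < n)%N ->
    (2 <= kappa (complement G))%N ->
  exists w1 w2, [/\ w1 != w2, w1 != u, w2 != u, ~~ G u w1 & ~~ G u w2].
Proof.
move=> n2 kG; have c2 : (2 < #|'I_n|)%N by rewrite card_ord.
have other v : v != u -> exists w, [/\ w != v, w != u & ~~ G u w].
  move=> vu; have [x] := exists_notin (c2 : (size [:: v; u] < _)%N).
  rewrite !inE negb_or => /andP[xv xu].
  rewrite eq_sym in vu; have := elimT (kappa_ge2P _ c2) kG v u x vu xv.
  case/(@connect_cross _ _ [set u]); rewrite ?inE // => a [b [ab]].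
  rewrite !inE => /eqP aE bu; move: ab; rewrite aE /deleted_rel !inE.
  move=> /and3P[_ bv ab]; exists b; split=> //; move: ab.
  by rewrite /= /simple_rel => /andP[_]; rewrite [G b u]adj_sym orbb.
have [v] := exists_notin (ltnW c2 : (size [:: u] < _)%N).
rewrite inE => /other[w1 [_ w1u n1]].
by have [w2 [w21 w2u nn2]] := other _ w1u; exists w1, w2; rewrite eq_sym.
Qed.

Lemma family_deg n (G : graph n) u : (2 < n)%N ->
  (2 <= kappa (complement G))%N -> (#|nbhd G u| + 3 <= n)%N.
Proof.
move=> n2 kG; have [w1 [w2 [w12 w1u w2u n1 nn2]]] := nonadj2 u n2 kG.
have c3 : #|[set u; w1; w2]| = 3%N.
  by rewrite setUC cardsU1 cards2 !inE negb_or w2u eq_sym w12 eq_sym w1u.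
have sub : [set u; w1; w2] \subset ~: nbhd G u.
  apply/subsetP => w; rewrite !inE -orbA.
  by case/or3P=> /eqP -> //; rewrite adj_irr.
by have := subset_leq_card sub; have := cardsC (nbhd G u); rewrite c3 card_ord; lia.
Qed.

Lemma edgeless_rho n (G : graph n) (t : R) f :
  (forall u w, ~~ G u w) -> eigenfun G t f -> t = 0.
Proof.
move=> noE [[u fu] fE]; have := fE u; rewrite /nbsum big_pred0 => [/esym/eqP|w].
  by rewrite mulf_eq0 (negPf fu) orbF => /eqP.
exact/negbTE.
Qed.

Lemma edgelessE n u w : edgeless n u w = false.
Proof. by rewrite /= /simple_rel andbF. Qed.

Lemma case3 : unique_extremal R 2 (edgeless 3) /\ spex_kappa R 3 2 = 0.
Proof.
have rho0 : rho R (edgeless 3) = 0.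
  have noE u w : ~~ edgeless 3 u w by rewrite edgelessE.
  apply: (@rho_eq _ _ _ _ (fun=> 1)) => // [|s y /(edgeless_rho noE)->//].
  split=> [|u]; first by exists ord0; rewrite oner_eq0.
  by rewrite mul0r /nbsum big_pred0 // => w; rewrite edgelessE.
rewrite -[in X in _ /\ X]rho0; apply: unique_extremal_of => //.
  split=> [x y z|]; first by rewrite edgelessE.
  apply/kappa_ge2P; first by rewrite card_ord.
  move=> v x y xv yv; have [->|xy] := eqVneq x y; first exact: connect0.
  apply: connect1; rewrite /deleted_rel !inE xv yv /=.
  by rewrite /simple_rel xy.
move=> G [tf kG]; left; exists id => [|u w]; first by exists id.
rewrite edgelessE; apply/esym/negbTE/negP => uw.
have := family_deg u (isT : (2 < 3)%N) kG.
by rewrite (cardsD1 w) inE uw addn3.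
Qed.

Definition matching (T : finType) (G : rel T) :=
  forall u v w, G u v -> G u w -> v = w.

(** Ends of an edge are joined in the complement graph through any third vertex, and a fourth vertex
    remains after deleting [v]. *)
Lemma matching_family n (G : graph n) : (3 < n)%N -> matching G ->
  @spex_family n 2 G.
Proof.
move=> n3 mG; split=> [x y z|].
  apply/negP => /and3P[xy yz xz]; have yE := mG _ _ _ xy xz.
  by rewrite yE adj_irr in yz.
apply/kappa_ge2P; first by rewrite card_ord; lia.
move=> v x y xv yv; have [->|xy] := eqVneq x y; first exact: connect0.
have step a b : a != v -> b != v -> a != b -> ~~ G a b ->
    connect (deleted_rel (complement G) [set v]) a b.
  move=> av bv ab nab; apply: connect1; rewrite /deleted_rel !inE av bv.
  by rewrite -[complement _ _ _]/((a != b) && (~~ G a b || ~~ G b a)) ab nab.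
have [Gxy|] := boolP (G x y); last exact: step.
have c3 : (size [:: v; x; y] < #|'I_n|)%N by rewrite card_ord.
have [w] := exists_notin c3; rewrite !inE !negb_or => /and3P[wv wx wy].
apply: (@connect_trans _ _ w); apply: step => //.
- by rewrite eq_sym.
- by apply: contra wy => xw; rewrite (mG _ _ _ xw Gxy).
rewrite adj_sym; rewrite adj_sym in Gxy.
by apply: contra wx => yw; rewrite (mG _ _ _ yw Gxy).
Qed.

Lemma matching_rho_le n (G : graph n) (t : R) f :
  matching G -> eigenfun G t f -> t <= 1.
Proof.
move=> mG ex; apply: le_trans (ler_norm _) _.
apply: (@eigen_le _ _ _ _ _ (fun=> 1)) ex => // u.
rewrite /nbsum sumr_const mulr1 -[leRHS]/(1%:R) ler_nat.
by apply/card_le1P => v uv w; rewrite inE; apply/idP/eqP => [uw|->//]; apply: mG uw uv.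
Qed.

Lemma matching_rho n (G : graph n) u v : matching G -> G u v -> rho R G = 1.
Proof.
move=> mG uv; have vu : G v u by rewrite adj_sym.
(* The indicator of an edge of a matching is an eigenfunction for 1. *)
pose f w : R := (w \in [set u; v])%:R.
apply: (@rho_eq _ _ _ _ f) => // [|s g]; last exact: matching_rho_le.
split=> [|w]; first by exists u; rewrite /f !inE eqxx oner_eq0.
rewrite mul1r /nbsum.
have single a b : G a b -> \sum_(c | G a c) f c = f b.
  move=> ab; rewrite (big_pred1 b) // => c.
  by apply/idP/eqP => [ac|->//]; apply: mG ac ab.
have [->|wu] := eqVneq w u; first by rewrite (single _ _ uv) /f !inE !eqxx orbT.
have [->|wv] := eqVneq w v; first by rewrite (single _ _ vu) /f !inE !eqxx orbT.
rewrite {2}/f !inE (negPf wu) (negPf wv) big1 // => c wc.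
rewrite /f !inE; case: eqVneq => [cu|_] /=.
  by move: wc; rewrite cu adj_sym => uw; rewrite (mG _ _ _ uw uv) eqxx in wv.
case: eqVneq => // cv.
by move: wc; rewrite cv adj_sym => vw; rewrite (mG _ _ _ vw vu) eqxx in wu.
Qed.

Lemma family4_matching (G : graph 4) : @spex_family 4 2 G -> matching G.
Proof.
move=> [_ kG] u v w uv uw; have := family_deg u (isT : (2 < 4)%N) kG.
rewrite -[4%N]/(1 + 3)%N leq_add2r => /card_le1_eqP; apply; by rewrite inE.
Qed.

Lemma gunion_matching (H : graph 2) : matching (gunion (complete 2) H).
Proof.
have two (a b c : 'I_2) : a != b -> a != c -> b = c.
  by case: a b c => [[|[|]]] // ? [[|[|]]] // ? [[|[|]]] // ? *; apply: val_inj.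
have irr (K : graph 2) a b : K a b -> a != b.
  by apply: contraTneq => ->; rewrite adj_irr.
have half (K : graph 2) a b : K a b || K b a -> a != b.
  by rewrite [K b a]adj_sym orbb; apply: irr.
move=> [a|a] [b|b] [c|c] //=; rewrite /simple_rel => /andP[_] // /half ab;
  by case/andP=> _ // /half ac; rewrite (two _ _ _ ab ac).
Qed.

Lemma matching_giso (T U : finType) (G : sgraph T) (H : sgraph U) :
  giso G H -> matching H -> matching G.
Proof.
move=> [f fb fE] mH u v w; rewrite -!fE => uv uw.
exact: bij_inj fb _ _ (mH _ _ _ uv uw).
Qed.

(** Once [uv] is an edge of the matching, only the pair [pq] is undetermined, and [H] records it. *)
Lemma giso_gunion4 (G : graph 4) (H : graph 2) u v p q :
    matching G -> uniq [:: u; v; p; q] -> G u v -> H 0 1 = G p q ->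
  giso G (gunion (complete 2) H).
Proof.
move=> mG us uv HE; apply: giso_sym.
pose idx (a : 'I_2 + 'I_2) : nat := match a with inl i => i | inr i => i.+2 end.
pose f a : 'I_4 := nth u [:: u; v; p; q] (idx a).
have vu : G v u by rewrite adj_sym.
have non a b c : G a b -> b != c -> G a c = false.
  by move=> ab bc; apply/negbTE; apply: contra bc => ac; rewrite (mG _ _ _ ab ac).
have := us; rewrite /= !inE !negb_or !andbT.
move=> /and3P[/and3P[nuv nup nuq] /andP[nvp nvq] npq].
have ups := (non _ _ _ uv nvp, non _ _ _ uv nvq, non _ _ _ vu nup, non _ _ _ vu nuq).
have HE' : H 1 0 = G p q by rewrite adj_sym.
exists f.
  apply: inj_card_bij; last by rewrite card_sum !card_ord.
  have idx_lt a : (idx a < 4)%N.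
    case: a => i; first exact: ltn_trans (ltn_ord i) _.
    exact: ltn_ord i.
  move=> a b /eqP; rewrite /f nth_uniq //.
  case: a b => i [] j; have := ltn_ord i; have := ltn_ord j => /= jlt ilt.
  - by move=> /eqP ij; congr inl; apply: val_inj.
  - by move=> /eqP ij; move: ilt; rewrite ij.
  - by move=> /eqP ij; move: jlt; rewrite -ij.
  - by move=> /eqP [ij]; congr inr; apply: val_inj.
have ord2 (i : 'I_2) : i = 0 \/ i = 1.
  by case: i => [[|[|]]] // i; [left | right]; apply: val_inj.
have upss := (etrans (adj_sym G p u) ups.1.1.1, etrans (adj_sym G q u) ups.1.1.2,
  etrans (adj_sym G p v) ups.1.2, etrans (adj_sym G q v) ups.2, ups).
move=> [i|i] [j|j]; have [->|->] := ord2 i; have [->|->] := ord2 j;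
  rewrite /f /= ?adj_irr ?upss /simple_rel ?eqxx ?uv ?vu //=.
  by rewrite HE HE' orbb.
by rewrite HE HE' orbb adj_sym.
Qed.

End ExtremalGraphs.

(** * Orders four and five, and the threshold *)

Section FourAndFive.
Variable R : realType.

Lemma mem_full_seq (T : finType) (s : seq T) x :
  uniq s -> size s = #|T| -> x \in s.
Proof.
move=> us sT; apply/negPn/negP => xs.
have /card_uniqP : uniq (x :: s) by rewrite /= xs.
by move=> /= cE; have := max_card (mem (x :: s)); rewrite cE sT ltnn.
Qed.

Lemma rho_no_edge n (G : graph n) : (forall u v, ~~ G u v) -> rho R G <= 0.
Proof. by move=> noE; apply: rho_le => // t f /(edgeless_rho noE) ->. Qed.

Lemma gunion4_edge (H : graph 2) (G : graph 4) :
  giso G (gunion (complete 2) H) -> exists u v, G u v.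
Proof.
case=> f [g fK gK] fE; exists (g (inl 0)), (g (inl 1)).
by rewrite -fE !gK.
Qed.

Lemma matching4_giso (G : graph 4) u v : matching G -> G u v ->
  giso G (gunion (complete 2) (edgeless 2)) \/
  giso G (gunion (complete 2) (complete 2)).
Proof.
move=> mG uv.
have nuv : u != v by apply: contraTneq uv => ->; rewrite adj_irr.
have [p [q [npq pqE]]] : exists p q, p != q /\ ~: [set u; v] = [set p; q].
  apply/cards2P; have := cardsC [set u; v].
  by rewrite cards2 nuv card_ord => /addnI ->.
have us : uniq [:: u; v; p; q].
  have /setP E := pqE; have := E p; have := E q; rewrite !inE !eqxx orbT.
  rewrite /= !inE !negb_or nuv npq /= andbT.
  by rewrite ![p == _]eq_sym ![q == _]eq_sym => /andP[-> ->] /andP[-> ->].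
have [pq|pq] := boolP (G p q).
  by right; apply: (giso_gunion4 mG us uv); rewrite pq.
by left; apply: (giso_gunion4 mG us uv); rewrite edgelessE (negPf pq).
Qed.

Lemma case4 : (forall G : graph 4, extremal R 2 G <->
    giso G (gunion (complete 2) (edgeless 2)) \/
    giso G (gunion (complete 2) (complete 2))) /\ spex_kappa R 4 2 = 1.
Proof.
(* A single edge shows that 1 is attained, which rules out the edgeless graph. *)
pose X : graph 4 := graph_of (fun i j : 'I_4 => (i == 0) && (j == 1)).
have mX : matching X.
  by move=> [[|[|[|[|]]]] // ?] [[|[|[|[|]]]] // ?] [[|[|[|[|]]]] // ?] //= *;
    apply: val_inj.
have rhoX : rho R X = 1 by apply: (matching_rho R mX (_ : X 0 1)).
have fX := matching_family (isT : (3 < 4)%N) mX.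
have max1 (G : graph 4) : @spex_family 4 2 G -> rho R G <= 1.
  move=> /family4_matching mG; apply: rho_le => // t f.
  exact: matching_rho_le.
split; last by rewrite (spex_kappa_eq fX) // rhoX.
move=> G; split=> [[fG maxG]|GK].
  have mG := family4_matching fG.
  have [/existsP[u /existsP[v uv]]|noE] := boolP [exists u, exists v, G u v].
    exact: matching4_giso mG uv.
  have : rho R G <= 0.
    apply: rho_no_edge => u v; apply: contra noE => uv.
    by apply/existsP; exists u; apply/existsP; exists v.
  by have := maxG X fX; rewrite rhoX => /le_trans h /h; rewrite ler10.
have [H GH] : exists H : graph 2, giso G (gunion (complete 2) H).
  by case: GK => GH; eexists; exact: GH.
have mG := matching_giso GH (@gunion_matching H).
have [u [v uv]] := gunion4_edge GH.
split; first exact: matching_family.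
by move=> K /max1; rewrite (matching_rho R mG uv).
Qed.

(** At a maximum of [|f|], at most two neighbours must contribute [2 |f u|], so there are exactly
    two and both attain the maximum. *)
Lemma max_nbr (G : graph 5) (f : 'I_5 -> R) u :
    eigenfun G 2 f -> (#|nbhd G u| <= 2)%N -> 0 < `|f u| ->
    (forall w, `|f w| <= `|f u|) ->
  #|nbhd G u| = 2 /\ forall w, G u w -> `|f w| = `|f u|.
Proof.
move=> ex d2 fu fmax.
have := nbsum_norm u ex; rewrite ger0_norm // => le2.
have sumE : \sum_(w in nbhd G u) (`|f u| - `|f w|) =
    #|nbhd G u|%:R * `|f u| - nbsum G (fun w => `|f w|) u.
  rewrite sumrB sumr_const mulr_natl; congr (_ - _).
  by apply: eq_bigl => w; rewrite inE.
have d2R : #|nbhd G u|%:R <= 2 :> R by rewrite ler_nat.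
have terms w : w \in nbhd G u -> 0 <= `|f u| - `|f w| by rewrite subr_ge0.
have sum_ge0 : 0 <= \sum_(w in nbhd G u) (`|f u| - `|f w|).
  exact: sumr_ge0.
have dE : #|nbhd G u| = 2.
  apply/eqP; rewrite eqn_leq d2 /= leqNgt; apply/negP => d1.
  have : #|nbhd G u|%:R <= 1 :> R by rewrite -[1]/(1%:R) ler_nat -ltnS.
  move=> /(ler_wpM2r (ltW fu)); rewrite sumE in sum_ge0; lra.
split=> // w uw; have /eqP : \sum_(w in nbhd G u) (`|f u| - `|f w|) = 0.
  by apply/eqP; rewrite eq_le sum_ge0 andbT sumE dE; lra.
rewrite psumr_eq0 // => /allP/(_ w); rewrite mem_index_enum inE uw subr_eq0.
by move=> /(_ isT)/eqP ->.
Qed.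

Lemma other_elt (T : finType) (A : {set T}) u : #|A| = 2 -> u \in A ->
  exists2 v, v != u & A = [set u; v].
Proof.
move=> /eqP/cards2P[a [b [ab ->]]]; rewrite !inE => /orP[]/eqP->.
  by exists b; rewrite // eq_sym.
by exists a; rewrite // setUC.
Qed.

(** All degrees are at most 2, and from a maximum of [|f|] the maximum, with degree 2, spreads along
    edges. Hence the walk from [u] both ways closes into a 4-cycle or a 5-cycle. *)
Lemma family5_c5 (G : graph 5) (f : 'I_5 -> R) :
  @spex_family 5 2 G -> eigenfun G 2 f -> giso G (cycle_graph 5).
Proof.
move=> [tf kG] ex; have card5 : (4 < #|'I_5|)%N by rewrite card_ord.
have d2 u : (#|nbhd G u| <= 2)%N.
  by have := family_deg u (isT : (2 < 5)%N) kG; rewrite -[5%N]/(2 + 3)%N leq_add2r.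
have [u fmax] : exists u, forall w, `|f w| <= `|f u|.
  have [u _ umax] := @arg_maxP _ R 'I_5 ord0 xpredT (fun w => `|f w|) isT.
  by exists u => w; apply: umax.
have fu : 0 < `|f u|.
  by have [[w fw] _] := ex; apply: lt_le_trans (fmax w); rewrite normr_gt0.
have step a : `|f a| = `|f u| -> #|nbhd G a| = 2 /\ forall w, G a w -> `|f w| = `|f u|.
  by move=> fa; have := max_nbr ex (d2 a); rewrite fa => /(_ fu fmax).
have [/eqP/cards2P[v [w [nvw Nu]]] eu] := step u erefl.
have N_adj a b c : nbhd G a = [set b; c] -> forall d, G a d = (d == b) || (d == c).
  by move=> /setP E d; have := E d; rewrite !inE.
have Gu := N_adj _ _ _ Nu.
have uv : G u v by rewrite Gu eqxx.
have uw : G u w by rewrite Gu eqxx orbT.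
have next a : G u a -> exists2 b, b != u & forall d, G a d = (d == u) || (d == b).
  move=> ua; have [cN _] := step a (eu a ua).
  have [|b bu Na] := @other_elt _ _ u cN; first by rewrite inE adj_sym.
  by exists b => //; apply: N_adj Na.
have [p pu Gv] := next v uv; have [q qu Gw] := next w uw.
have vp : G v p by rewrite Gv eqxx orbT.
have wq : G w q by rewrite Gw eqxx orbT.
have neq a b : G a b -> a != b by apply: contraTneq => ->; rewrite adj_irr.
have pw : p != w by apply: contraTneq vp => ->; apply/negP => vw; apply: (triangle tf uv vw uw).
have qv : q != v.
  by apply: contraTneq wq => ->; apply/negP => wv; apply: (triangle tf uw wv uv).
have fp : `|f p| = `|f u|.
  have [_ ev] := step v (eu v uv); exact: ev.
have [cNp _] := step p fp.
have [r rv Np] : exists2 r, r != v & nbhd G p = [set v; r].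
  by apply: other_elt => //; rewrite inE adj_sym.
have Gp := N_adj _ _ _ Np.
have nuv := neq _ _ uv; have nuw := neq _ _ uw.
have nvp := neq _ _ vp; have nwq := neq _ _ wq.
(* For a 4-cycle [u v p w], deleting the fifth vertex [s] from the complement graph separates [u],
   [p] from [v], [w]. *)
have [pq|pq] := eqVneq p q.
  have wp : G w p by rewrite pq.
  have [s] := @exists_notin _ [:: u; v; w; p] (card5 : 4 < _)%N.
  rewrite !inE !negb_or => /and4P[su sv sw sp].
  rewrite eq_sym in su; rewrite eq_sym in sv.
  have := elimT (kappa_ge2P _ (ltnW (ltnW card5))) kG s u v su sv.
  case/(@connect_cross _ _ [set u; p]); rewrite ?inE ?eqxx ?negb_or //.
    by rewrite eq_sym nuv.
  move=> a [b [ab aup bup]]; move: ab; rewrite /deleted_rel !inE => /and3P[_ bs].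
  rewrite /= /simple_rel [G b a]adj_sym orbb => /andP[_].
  have : (b == v) || (b == w).
    have : b \in [:: u; v; w; p; s].
      have us : uniq [:: u; v; w; p; s].
        rewrite /= !inE !negb_or nuv nuw nvw nvp [w == p]eq_sym pw.
        by rewrite [u == p]eq_sym pu su sv [w == s]eq_sym sw [p == s]eq_sym sp.
      by apply: mem_full_seq us _; rewrite card_ord.
    by move: bup; rewrite !inE negb_or => /andP[/negPf-> /negPf->] /=;
      rewrite (negPf bs) !orbF.
  move: aup; rewrite !inE => /orP[]/eqP-> /orP[]/eqP->.
  - by rewrite uv.
  - by rewrite uw.
  - by rewrite adj_sym vp.
  - by rewrite adj_sym wp.
have us : uniq [:: u; v; p; q; w].
  rewrite /= !inE !negb_or nuv [u == p]eq_sym pu [u == q]eq_sym qu nuw nvp.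
  by rewrite [v == q]eq_sym qv nvw pq pw [q == w]eq_sym nwq.
have all5 b : b \in [:: u; v; p; q; w].
  by apply: mem_full_seq us _; rewrite card_ord.
have rq : r = q.
  have pr : G p r by rewrite Gp eqxx orbT.
  have := all5 r; rewrite !inE (negPf rv) /= => /or4P[]/eqP rE //.
  - by move: pr; rewrite rE adj_sym Gu (negPf pw) [p == v]eq_sym (negPf nvp).
  - by move: pr; rewrite rE adj_irr.
  - by move: pr; rewrite rE adj_sym Gw (negPf pu) (negPf pq).
rewrite {}rq in Gp Np rv.
have Gq d : G q d = (d == p) || (d == w).
  have qp : G q p by rewrite adj_sym Gp eqxx orbT.
  have qw : G q w by rewrite adj_sym.
  have [p' _ Nq] : exists2 p', p' != p & nbhd G q = [set p; p'].
    apply: other_elt; last by rewrite inE.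
    have fq : `|f q| = `|f u| by have [_ ew] := step w (eu w uw); exact: ew.
    by have [] := step q fq.
  have Gq' := N_adj _ _ _ Nq; rewrite Gq'; move: qw.
  by rewrite Gq' [w == p]eq_sym (negPf pw) /= => /eqP ->.
apply: (@giso_of_seq _ _ _ _ [:: u; v; p; q; w] u) => //; first exact: card_ord.
move: us; rewrite /= !inE !negb_or !andbT.
move=> /and4P[/and4P[n1 n2 n3 n4] /and3P[n5 n6 n7] /andP[n8 n9] n10].
have nE := (negPf n1, negPf n2, negPf n3, negPf n4, negPf n5, negPf n6, negPf n7,
  negPf n8, negPf n9, negPf n10).
by move=> [[|[|[|[|[|]]]]] // ?] [[|[|[|[|[|]]]]] // ?] /=;
  rewrite ?Gu ?Gv ?Gp ?Gq ?Gw ?eqxx ?orbT ?nE // eq_sym ?nE // eq_sym ?nE //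
    orbC eq_sym ?nE.
Qed.

Lemma c5_nbsum (u : 'I_5) : nbsum (cycle_graph 5) (fun=> 1 : R) u = 2.
Proof.
rewrite /nbsum sumr_const -[RHS]/(2%:R); congr _%:R.
rewrite -sum1_card big_mkcond /= !big_ord_recl big_ord0.
by case: u => [[|[|[|[|[|]]]]] // ?].
Qed.

Lemma c5_eigen : eigenfun (cycle_graph 5) 2 (fun=> 1 : R).
Proof.
split=> [|u]; first by exists ord0; rewrite oner_eq0.
by rewrite c5_nbsum mulr1.
Qed.

Lemma rho_c5 : rho R (cycle_graph 5) = 2.
Proof.
apply: rho_eq c5_eigen _ => // s f ex; apply: le_trans (ler_norm _) _.
by apply: (@eigen_le _ _ _ _ _ (fun=> 1)) ex => // u; rewrite c5_nbsum mulr1.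
Qed.

(** The complement of the 5-cycle is the 5-cycle 0, 2, 4, 1, 3, and deleting a vertex leaves a
    path. *)
Lemma c5_family : @spex_family 5 2 (cycle_graph 5).
Proof.
split.
  by move=> [[|[|[|[|[|]]]]] // ?] [[|[|[|[|[|]]]]] // ?] [[|[|[|[|[|]]]]] // ?].
apply/kappa_ge2P; first by rewrite card_ord.
pose i0 : 'I_5 := @Ordinal 5 0 isT. pose i1 : 'I_5 := @Ordinal 5 1 isT.
pose i2 : 'I_5 := @Ordinal 5 2 isT. pose i3 : 'I_5 := @Ordinal 5 3 isT.
pose i4 : 'I_5 := @Ordinal 5 4 isT.
have via v a p : path (deleted_rel (complement (cycle_graph 5)) [set v]) a p ->
    (forall x, x != v -> x \in a :: p) -> forall x y, x != v -> y != v ->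
    connect (deleted_rel (complement (cycle_graph 5)) [set v]) x y.
  move=> ap all x y /all xp /all yp; apply: (@connect_trans _ _ a).
    by rewrite (sym_connect_sym (deleted_sym _ _)) (path_connect ap).
  exact: path_connect ap _ yp.
have cover v s : (forall x, x \in v :: s) -> forall x : 'I_5, x != v -> x \in s.
  by move=> vs x /negPf xv; have := vs x; rewrite inE xv.
have ord5 (x : 'I_5) : [\/ x = i0, x = i1, x = i2 | x = i3 \/ x = i4].
  case: x => [[|[|[|[|[|]]]]] // h].
  - by constructor 1; apply: val_inj.
  - by constructor 2; apply: val_inj.
  - by constructor 3; apply: val_inj.
  - by constructor 4; left; apply: val_inj.
  - by constructor 4; right; apply: val_inj.
move=> v; have [->|->|->|[->|->]] := ord5 v.
- apply: (via _ i2 [:: i4; i1; i3]); first by rewrite /= /deleted_rel !inE.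
  by apply: cover => x; have [->|->|->|[->|->]] := ord5 x; rewrite !inE.
- apply: (via _ i3 [:: i0; i2; i4]); first by rewrite /= /deleted_rel !inE.
  by apply: cover => x; have [->|->|->|[->|->]] := ord5 x; rewrite !inE.
- apply: (via _ i4 [:: i1; i3; i0]); first by rewrite /= /deleted_rel !inE.
  by apply: cover => x; have [->|->|->|[->|->]] := ord5 x; rewrite !inE.
- apply: (via _ i0 [:: i2; i4; i1]); first by rewrite /= /deleted_rel !inE.
  by apply: cover => x; have [->|->|->|[->|->]] := ord5 x; rewrite !inE.
- apply: (via _ i1 [:: i3; i0; i2]); first by rewrite /= /deleted_rel !inE.
  by apply: cover => x; have [->|->|->|[->|->]] := ord5 x; rewrite !inE.
Qed.

Lemma case5 : unique_extremal R 2 (cycle_graph 5) /\ spex_kappa R 5 2 = 2.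
Proof.
rewrite -[in X in _ /\ X]rho_c5; apply: unique_extremal_of => //.
  exact: c5_family.
(* Degrees at most 2 bound the eigenvalues by 2, and the value 2 itself forces the 5-cycle. *)
move=> G fG; have [[f ex]|no2] := pselect (exists f, eigenfun G (2 : R) f).
  by left; apply: family5_c5 ex.
right; rewrite rho_c5; apply: rho_lt => // t f ex.
have le2 : t <= 2.
  apply: le_trans (ler_norm _) _.
  apply: (@eigen_le _ _ _ _ _ (fun=> 1)) ex => // u.
  have := family_deg u (isT : (2 < 5)%N) fG.2.
  rewrite -[5%N]/(2 + 3)%N leq_add2r mulr1 /nbsum sumr_const -[leRHS]/(2%:R) ler_nat.
  by rewrite cardsE.
rewrite lt_neqAle le2 andbT; apply/eqP => t2; apply: no2.
by exists f; rewrite -t2.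
Qed.

Lemma case6 n : (6 <= n)%N ->
  unique_extremal R 2 (B n 2) /\ spex_kappa R n 2 = rho R (B n 2).
Proof.
move=> n6; apply: unique_extremal_of; first by lia.
  exact: B_family.
by move=> G; apply: family_giso_or_lt.
Qed.

(** In [B 5 2] the vertex 0 loses its edge to 3 and keeps only 4 as a neighbour, while the 5-cycle
    is 2-regular. *)
Lemma c5_not_B : ~ giso (cycle_graph 5) (B 5 2).
Proof.
case=> f [g fK gK] fE.
have two (x : 'I_5) : exists a b, [/\ a != b, cycle_graph 5 x a & cycle_graph 5 x b].
  exists (inord (x.+1 %% 5)), (inord ((x + 4) %% 5)).
  by case: x => [[|[|[|[|[|]]]]] // h]; split;
    rewrite -?val_eqE /= /simple_rel -?val_eqE /= !inordK.
have [a [b [ab ga gb]]] := two (g ord0).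
have one (i : 'I_5) : B 5 2 ord0 i -> i = ord_max.
  by case: i => [[|[|[|[|[|]]]]] // h] // _; apply: val_inj.
rewrite -fE gK in ga; rewrite -fE gK in gb.
by case/eqP: ab; apply: (can_inj fK); rewrite (one _ ga) (one _ gb).
Qed.

End FourAndFive.

Theorem theorem4p6 (R : realType) :
  (forall n : nat, (3 <= n)%N ->
     spex_kappa R n 2 =
       if n == 3%N then 0 else
       if n == 4%N then 1 else
       if n == 5%N then 2 else rho R (B n 2)) /\
  unique_extremal R 2 (edgeless 3) /\
  (forall G : graph 4,
     extremal R 2 G <->
     giso G (gunion (complete 2) (edgeless 2)) \/
     giso G (gunion (complete 2) (complete 2))) /\
  unique_extremal R 2 (cycle_graph 5) /\
  (forall n : nat, (6 <= n)%N -> unique_extremal R 2 (B n 2)) /\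
  is_n0 R 2 6.
Proof.
have [u3 s3] := case3 R; have [u4 s4] := case4 R; have [u5 s5] := case5 R.
have c6 := @case6 R.
split; [|split=> //; split=> //; split=> //; split; [|split]].
- move=> n n3; case: eqP => [->//|n3']; case: eqP => [->//|n4'].
  by case: eqP => [->//|n5']; apply: (c6 n _).2; lia.
- by move=> n /c6[].
- by move=> n n6; split; [lia | case: (c6 n n6)].
(* A threshold of at most 5 would make [B 5 2] the extremal graph of order 5, hence isomorphic to
   the 5-cycle. *)
move=> M MB; rewrite leqNgt; apply/negP => M5.
have [_ uB] := MB 5%N M5; apply: c5_not_B; apply/uB.
by apply/u5; apply: giso_refl.
Qed.
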